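(* Let $(A\to M,\varphi,\phi_A)$ be an invertible Hom-bundle. If $(\oplus_k\Gamma(\wedge^kA^* ),\wedge,\phi_A^\dagger,\mathrm{d})$ is a $(\phi_A^\dagger,\phi_A^\dagger)$-differential graded commutative algebra, then $(A,\varphi,\phi_A,[\cdot,\cdot]_A,a_A)$ is a Hom-Lie algebroid, where for all $\xi\in\Gamma(A^* )$, $x,x_1,x_2\in\Gamma(A)$ and $f\in C^\infty(M)$ the anchor $a_A$ and the bracket $[\cdot,\cdot]_A$ are respectively defined by $$a_A(x)(f)=\langle\mathrm{d}f,x\rangle$$ and $$\langle[x_1,x_2]_A,\xi\rangle=-\big(\mathrm{d}(\phi_A^\dagger)^{-1}(\xi)\big)(\phi_A(x_1),\phi_A(x_2))+a_A(\phi_A(x_1))\langle(\phi_A^\dagger)^{-1}(\xi),x_2\rangle-a_A(\phi_A(x_2))\langle(\phi_A^\dagger)^{-1}(\xi),x_1\rangle.$$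
   Context: Manifolds, bundles and maps are smooth; functions are real-valued. A Hom-Lie algebra $(\mathfrak g,[\cdot,\cdot],\phi)$ is a vector space with a skew-symmetric bilinear bracket and a linear map $\phi$ such that $\phi[x,y]=[\phi(x),\phi(y)]$ and $[\phi(x),[y,z]]+[\phi(y),[z,x]]+[\phi(z),[x,y]]=0$. A representation of it on a vector space $V$ with respect to $\beta\in\mathfrak{gl}(V)$ is a linear map $\rho:\mathfrak g\to\mathfrak{gl}(V)$ with $\rho(\phi(x))\circ\beta=\beta\circ\rho(x)$ and $\rho([x,y])\circ\beta=\rho(\phi(x))\circ\rho(y)-\rho(\phi(y))\circ\rho(x)$. For $\varphi:M\to M$, $\varphi^*f=f\circ\varphi$. A Hom-bundle $(A\to M,\varphi,\phi_A)$ is a vector bundle $A\to M$ with a smooth map $\varphi:M\to M$ and a linear map $\phi_A:\Gamma(A)\to\Gamma(A)$ such that $\phi_A(fx)=\varphi^*(f)\phi_A(x)$; it is invertible if $\varphi$ is a diffeomorphism and $\phi_A$ is invertible. $\phi_A$ is extended to $\Gamma(\wedge^kA)$ by $\phi_A(x_1\wedge\cdots\wedge x_k)=\phi_A(x_1)\wedge\cdots\wedge\phi_A(x_k)$ and to functions by $\varphi^*$. For an invertible Hom-bundle define $\phi_A^\dagger:\Gamma(\wedge^kA^* )\to\Gamma(\wedge^kA^* )$ by $(\phi_A^\dagger(\Xi))(X)=\varphi^*\big(\Xi(\phi_A^{-1}(X))\big)$ (so $\phi_A^\dagger=\varphi^*$ on functions). $\varphi^!TM$ is the pullback bundle of $TM$;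 a section $x$ acts on functions by $x(f)(m)=x_m(f)$, where $x_m\in T_{\varphi(m)}M$. When $\varphi$ is a diffeomorphism, $\Gamma(\varphi^!TM)$ is thereby identified with the set of $(\varphi^*,\varphi^* )$-derivations of $C^\infty(M)$, i.e. linear maps $x$ with $x(fg)=x(f)\varphi^*(g)+\varphi^*(f)x(g)$. A Hom-Lie algebroid $(A,\varphi,\phi_A,[\cdot,\cdot]_A,a_A)$ is a Hom-bundle $(A\to M,\varphi,\phi_A)$ with a Hom-Lie algebra structure $(\Gamma(A),[\cdot,\cdot]_A,\phi_A)$ and a bundle map $a_A:A\to\varphi^!TM$ (anchor) such that (i) $[x,fy]_A=\varphi^*(f)[x,y]_A+a_A(\phi_A(x))(f)\,\phi_A(y)$ for $x,y\in\Gamma(A)$, $f\in C^\infty(M)$; (ii) $a_A$ is a representation of $(\Gamma(A),[\cdot,\cdot]_A,\phi_A)$ on $C^\infty(M)$ with respect to $\varphi^*$. A $(\sigma,\tau)$-differential graded commutative algebra is a graded commutative algebra $\mathfrak A=\oplus_k\mathfrak A_k$ with degree $0$ algebra endomorphisms $\sigma,\tau$ and a degree $1$ (linear) operator $d:\mathfrak A_k\to\mathfrak A_{k+1}$ such that $d^2=0$, $d\sigma=\sigma d$, $d\tau=\tau d$, and $d(ab)=d(a)\tau(b)+(-1)^k\sigma(a)d(b)$ for $a\in\mathfrak A_k$, $b\in\mathfrak A_l$. *)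

(* Defs.v *)
From HB Require Import structures.
From mathcomp Require Import all_boot all_order all_algebra perm.
From mathcomp Require Import all_classical reals topology normedtype landau derive.
From mathcomp Require Import ring.
Set Implicit Arguments.
Unset Strict Implicit.
Unset Printing Implicit Defensive.
Import Order.TTheory GRing.Theory Num.Theory.
Import numFieldNormedType.Exports.
Local Open Scope classical_set_scope.
Local Open Scope ring_scope.

Lemma near_differentiable (R : realType) (V W : normedModType R) (f g : V -> W) x :
  (\forall y \near x, f y = g y) -> differentiable f x -> differentiable g x.
Proof.
move=> fg df.
have gx : g \o shift x = cst (g x) + 'd f x +o_ 0 id.
  apply/eqaddoP => e e0; have /eqaddoP/(_ e e0) := diff_locally df.
  apply: filter_app.
  rewrite -(nbhs_singleton fg).
  have : \forall h \near (0:V), f (h + x) = g (h + x).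
    by have := fg; rewrite (near_shift 0 x); apply: filterS => h /=; rewrite subr0.
  by apply: filterS => h /= fgh; rewrite fctE/= fgh.
have cd : continuous ('d f x) by exact: diff_continuous.
by apply/diff_locallyP; rewrite (diff_unique cd gx).
Qed.

Lemma row_continuous (R : realType) n (T : topologicalType) (g : T -> 'rV[R]_n) x :
  (forall c, {for x, continuous (fun y => g y ord0 c)}) -> {for x, continuous g}.
Proof.
move=> gc; apply/cvgrPdist_lt => e e0.
have : \forall t \near x, forall c, `|g x ord0 c - g t ord0 c| < e.
  by apply: filter_forall => c; have /cvgrPdist_lt/(_ e e0) := gc c.
apply: filterS => t gt.
rewrite -[ltLHS]/(mx_norm _) mx_normrE; apply/bigmax_ltP; split=> // -[i c] _ /=.
by rewrite !mxE !(ord1 i).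
Qed.

Lemma row_differentiable (R : realType) n (V : normedModType R)
    (g : V -> 'rV[R]_n) x :
  (forall c, differentiable (fun y => g y ord0 c) x) -> differentiable g x.
Proof.
move=> dg; rewrite (_ : g = \sum_c (fun y => g y ord0 c *: delta_mx 0 c)).
  by apply: differentiable_sum => c; exact: differentiableZl.
by rewrite fct_sumE; apply/funext => y; rewrite [LHS]row_sum_delta.
Qed.

Section SmoothEuclidean.
Context {R : realType} {n : nat}.
Implicit Types (f g : 'rV[R]_n -> R) (x : 'rV[R]_n).

(* f is of class C^k on some neighbourhood of x. *)
Fixpoint Ck_at (k : nat) (f : 'rV[R]_n -> R) (x : 'rV[R]_n) : Prop :=
  match k with
  | 0 => \forall y \near x, {for y, continuous f}
  | k'.+1 => (\forall y \near x, differentiable f y) /\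
             (forall v : 'rV[R]_n, Ck_at k' (fun y => 'D_v f y) x)
  end.

Definition smooth_at f x : Prop := forall k, Ck_at k f x.

Lemma Ck_at_near k f g x :
  (\forall y \near x, f y = g y) -> Ck_at k f x -> Ck_at k g x.
Proof.
elim: k f g => [|k IH] f g /near_join fg /=.
  move=> fc; apply: filterS2 fg fc => y yfg fc.
  rewrite /prop_for /continuous_at -(nbhs_singleton yfg).
  apply: cvg_trans fc; exact: (near_eq_cvg yfg).
case=> df Df; split.
  by apply: filterS2 fg df => y; exact: near_differentiable.
by move=> v; apply: IH (Df v); apply: filterS fg => y; exact: near_eq_derive.
Qed.

Lemma Ck_at_cst k (c : R) x : Ck_at k (fun=> c) x.
Proof.
elim: k c => [|k IH] c /=; first by apply: filterE => y; exact: cst_continuous.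
split; first by apply: filterE => y; exact: differentiable_cst.
by move=> v; under eq_fun do rewrite derive_cst; exact: IH.
Qed.

Lemma Ck_atW k f x : Ck_at k.+1 f x -> Ck_at k f x.
Proof.
elim: k f => [|k IH] f /=.
  by move=> [df _]; near=> y; apply: differentiable_continuous; near: y.
by move=> [df Df]; split=> // v; apply: IH; exact: Df.
Unshelve. all: by end_near.
Qed.

Lemma Ck_atD k f g x : Ck_at k f x -> Ck_at k g x -> Ck_at k (f \+ g) x.
Proof.
elim: k f g => [|k IH] f g /=.
  by move=> cf cg; apply: filterS2 cf cg => y fy gy; exact: (cvgD fy gy).
move=> [df Df] [dg Dg]; split.
  by apply: filterS2 df dg => y; exact: differentiableD.
move=> v; apply: Ck_at_near (IH _ _ (Df v) (Dg v)).
apply: filterS2 df dg => y df dg.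
by rewrite [RHS]deriveD//; exact: diff_derivable.
Qed.

Lemma Ck_atM k f g x : Ck_at k f x -> Ck_at k g x -> Ck_at k (f \* g) x.
Proof.
elim: k f g => [|k IH] f g.
  by move=> cf cg; apply: filterS2 cf cg => y fy gy; exact: (cvgM fy gy).
move=> Cf Cg; have [Cf' Cg'] := (Ck_atW Cf, Ck_atW Cg).
move: Cf Cg => [df Df] [dg Dg]; split.
  by apply: filterS2 df dg => y; exact: differentiableM.
move=> v; apply: Ck_at_near (Ck_atD (IH _ _ Cf' (Dg v)) (IH _ _ Cg' (Df v))).
apply: filterS2 df dg => y df dg.
by rewrite [RHS]deriveM//; exact: diff_derivable.
Qed.

Lemma Ck_at_sum k (I : finType) (F : I -> 'rV[R]_n -> R) x :
  (forall i, Ck_at k (F i) x) -> Ck_at k (fun y => \sum_i F i y) x.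
Proof.
move=> CF; rewrite -fct_sumE.
elim/big_ind : _ => //; first exact: Ck_at_cst.
by move=> f g; exact: Ck_atD.
Qed.

Lemma smooth_at_near f g x :
  (\forall y \near x, f y = g y) -> smooth_at f x -> smooth_at g x.
Proof. by move=> fg sf k; exact: Ck_at_near (sf k). Qed.

End SmoothEuclidean.

Section ChainRule.
Context {R : realType} {m n : nat}.

Lemma derive_row_comp (f : 'rV[R]_n -> R) (g : 'rV[R]_m -> 'rV[R]_n) x v :
  differentiable g x -> differentiable f (g x) ->
  'D_v (f \o g) x =
  \sum_c 'D_v (fun y => g y ord0 c) x * 'D_(delta_mx ord0 c) f (g x).
Proof.
move=> dg df; rewrite deriveE; last exact: differentiable_comp.
rewrite diff_comp//= [in LHS](row_sum_delta ('d g x v)) linear_sum /=.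
apply: eq_bigr => c _; rewrite linearZ /= -deriveE// -deriveE//.
rewrite derive_mx ?mxE//; exact: diff_derivable.
Qed.

Lemma Ck_at_comp k (f : 'rV[R]_n -> R) (g : 'rV[R]_m -> 'rV[R]_n) x :
  (forall c, Ck_at k (fun y => g y ord0 c) x) -> Ck_at k f (g x) ->
  Ck_at k (f \o g) x.
Proof.
elim: k f => [|k IH] f Cg Cf.
  have gc : \forall y \near x, {for y, continuous g}.
    have := filter_forall (f := fun c y =>
      {for y, continuous (fun z => g z ord0 c)}) (nbhs_filter x) Cg.
    by apply: filterS => y; exact: row_continuous.
  have fc : \forall y \near x, {for g y, continuous f}.
    exact: (nbhs_singleton gc) Cf.
  by rewrite /=; apply: filterS2 gc fc => y gy fy; exact: continuous_comp.
have Cg' c := Ck_atW (Cg c).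
have dg : \forall y \near x, differentiable g y.
  have := filter_forall (f := fun c y =>
    differentiable (fun z => g z ord0 c) y) (nbhs_filter x) (fun c => (Cg c).1).
  by apply: filterS => y; exact: row_differentiable.
case: Cf => df Df.
have {}df : \forall y \near x, differentiable f (g y).
  exact: (differentiable_continuous (nbhs_singleton dg)) df.
split; first by apply: filterS2 dg df => y; exact: differentiable_comp.
move=> v.
have : Ck_at k (fun y => \sum_c 'D_v (fun y => g y ord0 c) y *
                        ('D_(delta_mx ord0 c) f \o g) y) x.
  apply: Ck_at_sum => c; apply: Ck_atM; last exact: (IH _ Cg' (Df _)).
  by have [_] := Cg c; exact.
apply: Ck_at_near; apply: filterS2 dg df => y dg df.
by rewrite derive_row_comp.
Qed.

Lemma smooth_at_comp (f : 'rV[R]_n -> R) (g : 'rV[R]_m -> 'rV[R]_n) x :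
  (forall c, smooth_at (fun y => g y ord0 c) x) -> smooth_at f (g x) ->
  smooth_at (f \o g) x.
Proof. by move=> sg sf k; apply: Ck_at_comp => // c; exact: sg. Qed.

End ChainRule.

Section SmoothAt.
Context {R : realType} {n : nat}.
Implicit Types (f g : 'rV[R]_n -> R) (x : 'rV[R]_n).

Lemma smooth_at_cst (c : R) x : smooth_at (fun=> c) x.
Proof. by move=> k; exact: Ck_at_cst. Qed.

Lemma smooth_atD f g x :
  smooth_at f x -> smooth_at g x -> smooth_at (f \+ g) x.
Proof. by move=> sf sg k; exact: Ck_atD. Qed.

Lemma smooth_atM f g x :
  smooth_at f x -> smooth_at g x -> smooth_at (f \* g) x.
Proof. by move=> sf sg k; exact: Ck_atM. Qed.

End SmoothAt.

(* A smooth atlas on a Hausdorff second countable space. Charts and their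
   inverses are total functions; only chart i on chart_dom i and chart_inv i on
   its image are constrained. Adding compatible charts does not change the
   smooth functions and maps below, so the atlas need not be maximal. *)
Record manifold (R : realType) (n : nat) := Manifold {
  mcarrier :> topologicalType;
  chart_index : Type;
  chart_dom : chart_index -> set mcarrier;
  chart : chart_index -> mcarrier -> 'rV[R]_n;
  chart_inv : chart_index -> 'rV[R]_n -> mcarrier;
  manifold_hausdorff : hausdorff_space mcarrier;
  manifold_second_countable : @second_countable mcarrier;
  chart_cover : forall p, exists i, chart_dom i p;
  chart_dom_open : forall i, open (chart_dom i);
  chart_img_open : forall i, open (chart i @` chart_dom i);
  chartK : forall i p, chart_dom i p -> chart_inv i (chart i p) = p;
  chart_continuous : forall i p, chart_dom i p -> {for p, continuous (chart i)};
  chart_inv_continuous : forall i p, chart_dom i p ->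
    {for chart i p, continuous (chart_inv i)};
  chart_transition_smooth : forall i j p, chart_dom i p -> chart_dom j p ->
    forall c, smooth_at (fun y => chart j (chart_inv i y) ord0 c) (chart i p)
}.

Section SmoothFunctions.
Context {R : realType} {n : nat}.
Variable M : manifold R n.
Implicit Types (f g : M -> R) (p : M).

Definition fun_smooth_at f p : Prop :=
  forall i, chart_dom i p -> smooth_at (f \o chart_inv i) (chart i p).

Definition fun_smooth f : Prop := forall p, fun_smooth_at f p.

Lemma fun_smooth_at_cst (c : R) p : fun_smooth_at (fun=> c) p.
Proof. by move=> i _; exact: smooth_at_cst. Qed.

Lemma fun_smooth_atD f g p :
  fun_smooth_at f p -> fun_smooth_at g p -> fun_smooth_at (f \+ g) p.
Proof. by move=> sf sg i ip; apply: smooth_atD; [exact: sf | exact: sg]. Qed.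

Lemma fun_smooth_atM f g p :
  fun_smooth_at f p -> fun_smooth_at g p -> fun_smooth_at (f \* g) p.
Proof. by move=> sf sg i ip; apply: smooth_atM; [exact: sf | exact: sg]. Qed.

Lemma fun_smooth_at_sum (I : Type) (s : seq I) (F : I -> M -> R) p :
  (forall i, fun_smooth_at (F i) p) ->
  fun_smooth_at (fun q => \sum_(i <- s) F i q) p.
Proof.
move=> sF; rewrite -fct_sumE; elim/big_ind : _ => //.
  exact: fun_smooth_at_cst.
by move=> f g; exact: fun_smooth_atD.
Qed.

Lemma fun_smooth_at_prod (I : Type) (s : seq I) (F : I -> M -> R) p :
  (forall i, fun_smooth_at (F i) p) ->
  fun_smooth_at (fun q => \prod_(i <- s) F i q) p.
Proof.
move=> sF; rewrite -fct_prodE; elim/big_ind : _ => //.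
  exact: fun_smooth_at_cst.
by move=> f g; exact: fun_smooth_atM.
Qed.

Lemma near_chart i p (P : set M) : chart_dom i p ->
  (\forall q \near p, P q) -> \forall y \near chart i p, P (chart_inv i y).
Proof.
move=> ip pP; have /(_ P) := chart_inv_continuous ip.
by rewrite chartK//; exact.
Qed.

Lemma fun_smooth_at_near f g p :
  (\forall q \near p, f q = g q) -> fun_smooth_at f p -> fun_smooth_at g p.
Proof.
move=> fg sf i ip; apply: smooth_at_near (sf i ip).
exact: (@near_chart i p (fun q => f q = g q)).
Qed.

Definition smooth_pred : {pred M -> R} := mem [set f | fun_smooth f].

Lemma smooth_subring_closed : subring_closed smooth_pred.
Proof.
split=> [|f g|f g]; rewrite ?inE => sf.
- by move=> p; exact: fun_smooth_at_cst.
- move=> sg p; have -> : f - g = f \+ (cst (-1) \* g).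
    by apply/funext => q; rewrite /= mulN1r.
  apply: fun_smooth_atD (sf p) (fun_smooth_atM _ (sg p)).
  exact: fun_smooth_at_cst.
- by move=> sg p; exact: fun_smooth_atM (sf p) (sg p).
Qed.
HB.instance Definition _ :=
  GRing.isSubringClosed.Build _ smooth_pred smooth_subring_closed.

Lemma smooth_scaler_closed : scaler_closed smooth_pred.
Proof.
move=> c f; rewrite !inE => sf p.
by apply: fun_smooth_atM (sf p); exact: fun_smooth_at_cst.
Qed.
HB.instance Definition _ :=
  GRing.isScaleClosed.Build _ _ smooth_pred smooth_scaler_closed.

Record smooth_function := SmoothFunction {
  smooth_val :> M -> R;
  smooth_valP : smooth_val \in smooth_pred
}.
HB.instance Definition _ := [isSub for smooth_val].
HB.instance Definition _ := [Choice of smooth_function by <:].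
HB.instance Definition _ :=
  GRing.SubChoice_isSubComPzRing.Build _ _ smooth_function (subringClosedP _).
HB.instance Definition _ :=
  [SubZmodule_isSubLmodule of smooth_function by <:].

Lemma smooth_val_smooth (f : smooth_function) : fun_smooth f.
Proof. by have := smooth_valP f; rewrite inE. Qed.

Definition mk_smooth (f : M -> R) (sf : fun_smooth f) : smooth_function :=
  SmoothFunction (mem_set sf).

End SmoothFunctions.
Notation "'C^oo' ( M )" := (smooth_function M) (at level 0, format "'C^oo' ( M )").

Section SmoothMaps.
Context {R : realType} {m n : nat}.
Variables (M : manifold R m) (N : manifold R n).

Definition map_smooth (phi : M -> N) : Prop :=
  continuous phi /\
  forall p i j, chart_dom i p -> chart_dom j (phi p) -> forall c,
    smooth_at (fun y => chart j (phi (chart_inv i y)) ord0 c) (chart i p).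

Record smooth_map := SmoothMap {
  map_val :> M -> N;
  map_valP : map_smooth map_val
}.

Lemma pullback_subproof (phi : smooth_map) (f : C^oo(N)) :
  fun_smooth (f \o phi).
Proof.
have [cphi sphi] := map_valP phi.
move=> p i ip; have [j jp] := chart_cover (phi p).
apply: (@smooth_at_near _ _
  ((f \o chart_inv j) \o (fun y => chart j (phi (chart_inv i y))))).
  apply: (@near_chart _ _ _ i p
    (fun q => f (chart_inv j (chart j (phi q))) = f (phi q))) => //.
  have : \forall q \near p, chart_dom j (phi q).
    exact: cphi (open_nbhs_nbhs (conj (chart_dom_open j) jp)).
  by apply: filterS => q jq /=; rewrite chartK.
apply: smooth_at_comp; first exact: sphi.
by rewrite chartK//; exact: smooth_val_smooth.
Qed.

Definition pullback (phi : smooth_map) (f : C^oo(N)) : C^oo(M) :=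
  mk_smooth (pullback_subproof phi f).

End SmoothMaps.

Section Tangent.
Context {R : realType} {n : nat}.
Variables (M : manifold R n) (p : M).

(* T_pM is the space of derivations of C^oo(M) at p. *)
Definition point_derivation : {pred C^oo(M) -> R} :=
  mem [set v : C^oo(M) -> R | linear_for *%R v /\
        forall f g : C^oo(M), v (f * g) = v f * g p + f p * v g].

Lemma point_derivation_closed : submod_closed point_derivation.
Proof.
split=> [|a u v]; rewrite ?inE /=.
  split=> [a f g|f g]; first by rewrite mulr0 addr0.
  by rewrite mul0r mulr0 addr0.
move=> [ul uD] [vl vD]; split=> [b f g|f g]; rewrite !fctE.
  by rewrite ul vl /GRing.scale/=; ring.
by rewrite uD vD /GRing.scale/=; ring.
Qed.
HB.instance Definition _ :=
  GRing.isSubmodClosed.Build _ _ point_derivation point_derivation_closed.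

Record tangent := Tangent {
  tangent_val :> C^oo(M) -> R;
  tangent_valP : tangent_val \in point_derivation
}.
HB.instance Definition _ := [isSub for tangent_val].
HB.instance Definition _ := [Choice of tangent by <:].
HB.instance Definition _ := [SubChoice_isSubLmodule of tangent by <:].

End Tangent.

Section DependentFunctions.
Context {R : pzRingType} {T : Type}.
Variable V : T -> lmodType R.

Definition dfun := forall t, V t.

HB.instance Definition _ := gen_eqMixin dfun.
HB.instance Definition _ := gen_choiceMixin dfun.

Let add (x y : dfun) : dfun := fun t => x t + y t.
Let opp (x : dfun) : dfun := fun t => - x t.
Let scale (c : R) (x : dfun) : dfun := fun t => c *: x t.

Let addA : associative add.
Proof. by move=> x y z; apply/functional_extensionality_dep => t; exact: addrA. Qed.
Let addC : commutative add.
Proof. by move=> x y; apply/functional_extensionality_dep => t; exact: addrC. Qed.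
Let add0 : left_id (fun=> 0) add.
Proof. by move=> x; apply/functional_extensionality_dep => t; exact: add0r. Qed.
Let addN : left_inverse (fun=> 0) opp add.
Proof. by move=> x; apply/functional_extensionality_dep => t; exact: addNr. Qed.
HB.instance Definition _ :=
  GRing.isZmodule.Build dfun addA addC add0 addN.

Let scaleA a b (v : dfun) : scale a (scale b v) = scale (a * b) v.
Proof. by apply/functional_extensionality_dep => t; exact: scalerA. Qed.
Let scale1 : left_id 1 scale.
Proof. by move=> x; apply/functional_extensionality_dep => t; exact: scale1r. Qed.
Let scaleDr : right_distributive scale +%R.
Proof. by move=> a x y; apply/functional_extensionality_dep => t; exact: scalerDr. Qed.
Let scaleDl v : {morph scale^~ v : a b / a + b}.
Proof. by move=> a b; apply/functional_extensionality_dep => t; exact: scalerDl. Qed.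
HB.instance Definition _ :=
  GRing.Zmodule_isLmodule.Build R dfun scaleA scale1 scaleDr scaleDl.

End DependentFunctions.

(* A rank r vector bundle, given by its fibres and by fibrewise linear local
   trivializations with smooth transition functions; these determine the smooth
   structure of the total space. The data triv and triv_inv are only constrained
   over triv_dom. *)
Record vbundle (R : realType) (n : nat) (M : manifold R n) (r : nat) := VBundle {
  fibre :> M -> lmodType R;
  triv_index : Type;
  triv_dom : triv_index -> set M;
  triv : triv_index -> forall p, fibre p -> 'rV[R]_r;
  triv_inv : triv_index -> forall p, 'rV[R]_r -> fibre p;
  triv_cover : forall p, exists j, triv_dom j p;
  triv_dom_open : forall j, open (triv_dom j);
  triv_linear : forall j p, triv_dom j p -> linear (@triv j p);
  trivK : forall j p, triv_dom j p -> cancel (@triv j p) (@triv_inv j p);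
  triv_invK : forall j p, triv_dom j p -> cancel (@triv_inv j p) (@triv j p);
  triv_transition_smooth : forall j j' p, triv_dom j p -> triv_dom j' p ->
    forall b c, fun_smooth_at
      (fun q => triv j' (triv_inv j q (delta_mx ord0 b)) ord0 c) p
}.

Section Sections.
Context {R : realType} {n r : nat} {M : manifold R n}.
Variable A : vbundle M r.

Definition frame (j : triv_index A) (p : M) (b : 'I_r) : A p :=
  triv_inv j p (delta_mx ord0 b).

Lemma frameE j p (v : A p) : triv_dom j p ->
  v = \sum_b triv j v ord0 b *: frame j p b.
Proof.
move=> jp; apply: (can_inj (trivK jp)).
pose L := GRing.isLinear.Build _ _ _ _ _ (triv_linear jp).
pose f : {linear A p -> 'rV[R]_r} := HB.pack (@triv _ _ _ _ A j p) L.
rewrite -/(f v) -[RHS]/(f _) linear_sum [LHS]row_sum_delta; apply: eq_bigr => b _.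
by rewrite linearZ /= triv_invK.
Qed.

Definition section_smooth_at (x : forall p, A p) p : Prop :=
  forall j, triv_dom j p ->
  forall b, fun_smooth_at (fun q => triv j (x q) ord0 b) p.

Definition section_pred : {pred dfun A} :=
  mem [set x : dfun A | forall p, section_smooth_at x p].

Lemma triv0 j p : triv_dom j p -> triv j (0 : A p) = 0.
Proof.
move=> jp; have := triv_linear jp 1 0 0.
by rewrite !scale1r addr0 => /(congr1 (+%R^~ (- triv j (0 : A p)))) ;
   rewrite addrK subrr.
Qed.

Lemma section_closed : submod_closed section_pred.
Proof.
split=> [|a x y]; rewrite ?inE /=.
  move=> p j jp b.
  apply: (@fun_smooth_at_near _ _ _ (fun=> 0)); last exact: fun_smooth_at_cst.
  apply: filterS (open_nbhs_nbhs (conj (triv_dom_open j) jp)) => q jq.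
  by rewrite triv0 ?mxE.
move=> sx sy p j jp b.
apply: (@fun_smooth_at_near _ _ _
  ((cst a \* (fun q => triv j (x q) ord0 b)) \+ (fun q => triv j (y q) ord0 b))).
  apply: filterS (open_nbhs_nbhs (conj (triv_dom_open j) jp)) => q jq.
  by rewrite [in RHS]triv_linear//= !mxE.
apply: fun_smooth_atD; last exact: sy.
by apply: fun_smooth_atM; [exact: fun_smooth_at_cst | exact: sx].
Qed.
HB.instance Definition _ :=
  GRing.isSubmodClosed.Build _ _ section_pred section_closed.

Record smooth_section := SmoothSection {
  section_val : dfun A;
  section_valP : section_val \in section_pred
}.
HB.instance Definition _ := [isSub for section_val].
HB.instance Definition _ := [Choice of smooth_section by <:].
HB.instance Definition _ := [SubChoice_isSubLmodule of smooth_section by <:].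

Definition section_at (x : smooth_section) (p : M) : A p := section_val x p.
Coercion section_at : smooth_section >-> Funclass.

Lemma section_smooth (x : smooth_section) p : section_smooth_at x p.
Proof. by have := section_valP x; rewrite inE; exact. Qed.

Lemma fscale_subproof (f : C^oo(M)) (x : smooth_section) :
  ((fun p => f p *: x p) : dfun A) \in section_pred.
Proof.
rewrite inE /= => p j jp b.
apply: (@fun_smooth_at_near _ _ _ (f \* (fun q => triv j (x q) ord0 b))).
  apply: filterS (open_nbhs_nbhs (conj (triv_dom_open j) jp)) => q jq.
  have := triv_linear jq (f q) (x q) 0.
  by rewrite triv0// !addr0 => ->; rewrite mxE.
apply: fun_smooth_atM; first exact: smooth_val_smooth.
exact: section_smooth.
Qed.

Definition fscale (f : C^oo(M)) (x : smooth_section) : smooth_section :=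
  SmoothSection (fscale_subproof f x).

End Sections.
Notation "'Gamma' ( A )" := (smooth_section A)
  (at level 0, format "'Gamma' ( A )").

Section Multilinear.
Context {R : realType} {V : lmodType R} {k : nat}.
Implicit Types (w : ('I_k -> V) -> R) (v : 'I_k -> V).

Definition upd v (i : 'I_k) (u : V) : 'I_k -> V :=
  fun j => if j == i then u else v j.

Definition multilinear w : Prop :=
  forall i v, linear_for *%R (fun u => w (upd v i u)).

Definition alternating w : Prop :=
  forall v i j, i != j -> v i = v j -> w v = 0.

Lemma upd_id v i : upd v i (v i) = v.
Proof. by apply/funext => j; rewrite /upd; case: eqVneq => [->|]. Qed.

Lemma multilinear_sum w i v (I : Type) (s : seq I) (c : I -> R) (e : I -> V) :
  multilinear w ->
  w (upd v i (\sum_(b <- s) c b *: e b)) = \sum_(b <- s) c b * w (upd v i (e b)).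
Proof.
move=> ml.
have w0 : w (upd v i 0) = 0.
  have := ml i v (-1) 0 0.
  by rewrite scaler0 addr0 mulN1r addNr.
elim: s => [|b s IH]; first by rewrite !big_nil.
by rewrite !big_cons ml IH.
Qed.

End Multilinear.

Section Forms.
Context {R : realType} {n r : nat} {M : manifold R n}.
Variable A : vbundle M r.

(* kform A k is the space of smooth sections of the k-th exterior power of A^*,
   whose fibre at p is the space of alternating k-linear forms on A p. Smoothness
   is that of the coefficients in the local frames of A. *)
Definition kform_fibre (k : nat) (p : M) : lmodType R := ('I_k -> A p) -> R^o.

Definition kform_smooth_at k (w : dfun (kform_fibre k)) p : Prop :=
  forall j (s : 'I_k -> 'I_r), triv_dom j p ->
  fun_smooth_at (fun q => w q (fun i => frame j q (s i))) p.

Definition kform_pred k : {pred dfun (kform_fibre k)} :=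
  mem [set w : dfun (kform_fibre k) |
        forall p, [/\ multilinear (w p), alternating (w p) & kform_smooth_at w p]].
Arguments kform_pred : clear implicits.

Lemma kform_closed k : submod_closed (kform_pred k).
Proof.
split=> [|a w z]; rewrite ?inE /=.
  move=> p; split=> [i v b u u'|//|j s jp]; first by rewrite mulr0 addr0.
  exact: fun_smooth_at_cst.
move=> W Z p; have [[wl wa ws] [zl za zs]] := (W p, Z p).
have E v : (a *: w + z) p v = a * w p v + z p v by [].
split=> [i v b u u'|v i i' ii' vi|j s jp].
- by rewrite !E wl zl; ring.
- by rewrite E (wa _ _ _ ii')// (za _ _ _ ii')// mulr0 addr0.
- apply: fun_smooth_atD (zs _ _ jp); apply: fun_smooth_atM (ws _ _ jp).
  exact: fun_smooth_at_cst.
Qed.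
HB.instance Definition _ k :=
  GRing.isSubmodClosed.Build _ _ (kform_pred k) (@kform_closed k).

Record kform k := KForm {
  kform_val : dfun (kform_fibre k);
  kform_valP : kform_val \in kform_pred k
}.
HB.instance Definition _ k := [isSub for @kform_val k].
HB.instance Definition _ k := [Choice of kform k by <:].
HB.instance Definition _ k := [SubChoice_isSubLmodule of kform k by <:].

Definition kform_at k (w : kform k) (p : M) (v : 'I_k -> A p) : R := @kform_val k w p v.
Coercion kform_at : kform >-> Funclass.

Lemma kform_multilinear k (w : kform k) p : multilinear (w p).
Proof. by have := kform_valP w; rewrite inE => /(_ p)[]. Qed.
Lemma kform_alternating k (w : kform k) p : alternating (w p).
Proof. by have := kform_valP w; rewrite inE => /(_ p)[]. Qed.
Lemma kform_smooth k (w : kform k) p : kform_smooth_at (kform_val w) p.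
Proof. by have := kform_valP w; rewrite inE => /(_ p)[]. Qed.

Lemma kform_eval_subproof k (w : kform k) (X : 'I_k -> Gamma(A)) :
  fun_smooth (fun p => w p (fun i => X i p)).
Proof.
move=> p; have [j jp] := triv_cover A p.
suff H l (Y : 'I_k -> forall q, A q) : (l <= k)%N ->
    (forall i : 'I_k, (i < l)%N -> forall b,
       fun_smooth_at (fun q => triv j (Y i q) ord0 b) p) ->
    (forall i : 'I_k, (l <= i)%N -> exists b, Y i = (frame j)^~ b) ->
    fun_smooth_at (fun q => w q (Y^~ q)) p.
  apply: (H k (fun i => X i)) => // [i _ b|i]; first exact: section_smooth.
  by rewrite leqNgt ltn_ord.
elim: l Y => [|l IH] Y lk sY fY.
  have /choice[s sE] := fun i : 'I_k => fY i isT.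
  rewrite (_ : (fun q => _) = (fun q => w q (fun i => frame j q (s i)))).
    exact: kform_smooth.
  by apply/funext => q; congr (kform_at w _); apply/funext => i; rewrite sE.
pose i0 := Ordinal lk.
apply: (@fun_smooth_at_near _ _ _ (fun q =>
    \sum_b triv j (Y i0 q) ord0 b * w q (upd (Y^~ q) i0 (frame j q b)))).
  apply: filterS (open_nbhs_nbhs (conj (triv_dom_open j) jp)) => q jq.
  rewrite -multilinear_sum; last exact: kform_multilinear.
  by rewrite -frameE// (upd_id (Y^~ q)).
apply: fun_smooth_at_sum => b; apply: fun_smooth_atM; first exact: sY.
pose Z := fun i => if i == i0 then (frame j)^~ b else Y i.
rewrite (_ : (fun q => _) = (fun q => w q (Z^~ q))); last first.
  apply/funext => q; congr (kform_at w _); apply/funext => i.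
  by rewrite /upd /Z; case: eqP.
apply: IH => [|i il b'|i]; first exact: ltnW.
  rewrite /Z; case: eqVneq il => [->|_ il]; first by rewrite ltnn.
  by apply: sY; exact: ltnW.
rewrite leq_eqVlt /Z; case: (eqVneq i i0) => [_ _|ii0 /orP[/eqP li|]].
- by exists b.
- by case/eqP: ii0; apply: val_inj.
- exact: fY.
Qed.

Definition kform_eval k (w : kform k) (X : 'I_k -> Gamma(A)) : C^oo(M) :=
  mk_smooth (kform_eval_subproof w X).

Lemma kform0_subproof (f : C^oo(M)) :
  ((fun p => fun=> f p) : dfun (kform_fibre 0)) \in kform_pred 0.
Proof.
rewrite inE /= => p; split=> [[]|v []|j s jp] //.
exact: smooth_val_smooth.
Qed.

Definition kform0 (f : C^oo(M)) : kform 0 := KForm (kform0_subproof f).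

End Forms.
Arguments kform_pred {R n r M} A k.

Section Wedge.
Context {R : realType} {n r : nat} {M : manifold R n}.
Variable A : vbundle M r.

(* Determinant convention: (w /\ z)(x, y) = w(x) z(y) - w(y) z(x) for 1-forms. *)
Definition wedge_val k l (w : kform A k) (z : kform A l) : dfun (kform_fibre A (k + l)) :=
  fun p v => (k`! * l`!)%:R^-1 *
    \sum_(s : {perm 'I_(k + l)}) (-1) ^+ s *
      (w p (fun i => v (s (lshift l i))) * z p (fun i => v (s (rshift k i)))).

Lemma wedge_subproof k l (w : kform A k) (z : kform A l) :
  wedge_val w z \in kform_pred A (k + l).
Proof.
rewrite inE /= => p; split.
- move=> i v a u u'; rewrite /wedge_val [in RHS]mulrCA -[RHS]mulrDr; congr (_ * _).
  rewrite mulr_sumr -big_split; apply: eq_bigr => s _ /=.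
  rewrite [in RHS]mulrCA -[RHS]mulrDr; congr (_ * _).
  have E (m : nat) (g : 'I_m -> 'I_(k + l)) x : (forall h, g h != s^-1%g i) ->
      (fun h => upd v i x (s (g h))) = (fun h => v (s (g h))).
    move=> gi; apply/funext => h; rewrite /upd ifN//.
    by apply: contra (gi h) => /eqP <-; rewrite permK.
  have F (m : nat) (g : 'I_m -> 'I_(k + l)) h0 x :
      injective g -> g h0 = s^-1%g i ->
      (fun h => upd v i x (s (g h))) = upd (fun h => v (s (g h))) h0 x.
    move=> gI gi; apply/funext => h; rewrite /upd.
    by rewrite (canF_eq (permK s)) -gi (inj_eq gI).
  case: (splitP (s^-1%g i)) => h hi.
    have {}hi : lshift l h = s^-1%g i by apply: val_inj.
    have ri h' : rshift k h' != s^-1%g i by rewrite -hi eq_rlshift.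
    by rewrite !(F _ _ _ _ (@lshift_inj _ _) hi) !(E _ _ _ ri) kform_multilinear; ring.
  have {}hi : rshift k h = s^-1%g i by apply: val_inj.
  have li h' : lshift l h' != s^-1%g i by rewrite -hi eq_lrshift.
  by rewrite !(F _ _ _ _ (@rshift_inj _ _) hi) !(E _ _ _ li) kform_multilinear; ring.
- move=> v i j ij vij; rewrite /wedge_val; set S := \sum_s _.
  suff /eqP : S = - S by rewrite -addr_eq0 -mulr2n mulrn_eq0 /= => /eqP ->; rewrite mulr0.
  rewrite {1}/S (reindex_inj (mulIg (tperm i j))) -sumrN; apply: eq_bigr => s _.
  rewrite odd_permM odd_tperm ij addbT signrN mulNr; congr (- (_ * _)).
  have E x : v ((s * tperm i j)%g x) = v (s x).
    by rewrite permM; case: tpermP => // ->.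
  congr (_ * _).
    by congr (kform_at w); apply/funext => x; rewrite E.
  by congr (kform_at z); apply/funext => x; rewrite E.
- move=> j s jp; apply: fun_smooth_atM; first exact: fun_smooth_at_cst.
  apply: fun_smooth_at_sum => t; apply: fun_smooth_atM.
    exact: fun_smooth_at_cst.
  apply: fun_smooth_atM.
    exact: (kform_smooth w (fun i => s (t (lshift l i))) jp).
  exact: (kform_smooth z (fun i => s (t (rshift k i))) jp).
Qed.

Definition kwedge k l (w : kform A k) (z : kform A l) : kform A (k + l) :=
  KForm (wedge_subproof w z).

End Wedge.

Section GradedAlgebra.
Variables (R : fieldType) (G : nat -> lmodType R).

(* Reindexing of degrees that are equal but not convertible. *)
Definition gcast k l (e : k = l) (a : G k) : G l := eq_rect k (fun i => G i) a l e.

Variables (one : G 0) (mul : forall k l, G k -> G l -> G (k + l)%N).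

Record is_graded_comm_algebra : Prop := GradedCommAlgebra {
  gmul_linearl : forall k l (b : G l), linear (fun a : G k => mul a b);
  gmul_linearr : forall k l (a : G k), linear (fun b : G l => mul a b);
  gmulA : forall j k l (a : G j) (b : G k) (c : G l),
    gcast (addnA j k l) (mul a (mul b c)) = mul (mul a b) c;
  gmul1 : forall k (a : G k), mul one a = a;
  gmulC : forall k l (a : G k) (b : G l),
    mul a b = (-1) ^+ (k * l) *: gcast (addnC l k) (mul b a)
}.

Record is_graded_endomorphism (sigma : forall k, G k -> G k) : Prop :=
  GradedEndomorphism {
  gend_linear : forall k, linear (@sigma k);
  gend1 : sigma 0%N one = one;
  gendM : forall k l (a : G k) (b : G l),
    sigma (k + l)%N (mul a b) = mul (sigma k a) (sigma l b)
}.

Record is_dgca (sigma tau : forall k, G k -> G k)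
    (d : forall k, G k -> G k.+1) : Prop := DGCA {
  dgca_algebra : is_graded_comm_algebra;
  dgca_sigma : is_graded_endomorphism sigma;
  dgca_tau : is_graded_endomorphism tau;
  dgca_linear : forall k, linear (@d k);
  dgca_dd : forall k (a : G k), d k.+1 (d k a) = 0;
  dgca_d_sigma : forall k (a : G k), d k (sigma k a) = sigma k.+1 (d k a);
  dgca_d_tau : forall k (a : G k), d k (tau k a) = tau k.+1 (d k a);
  dgca_leibniz : forall k l (a : G k) (b : G l),
    d (k + l)%N (mul a b) =
      mul (d k a) (tau l b) +
      (-1) ^+ k *: gcast (addnS k l) (mul (sigma k a) (d l b))
}.

End GradedAlgebra.

Section HomLieAlgebra.
Variables (R : fieldType) (g : lmodType R) (br : g -> g -> g) (phi : g -> g).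

Record is_hom_lie_algebra : Prop := HomLieAlgebra {
  hla_linearl : forall y, linear (br^~ y);
  hla_linearr : forall x, linear (br x);
  hla_skew : forall x y, br x y = - br y x;
  hla_map_linear : linear phi;
  hla_map_bracket : forall x y, phi (br x y) = br (phi x) (phi y);
  hla_jacobi : forall x y z,
    br (phi x) (br y z) + br (phi y) (br z x) + br (phi z) (br x y) = 0
}.

Record is_hom_representation (V : lmodType R) (beta : V -> V)
    (rho : g -> V -> V) : Prop := HomRepresentation {
  hrep_beta_linear : linear beta;
  hrep_op_linear : forall x, linear (rho x);
  hrep_linear : forall v, linear (rho^~ v);
  hrep_map : forall x v, rho (phi x) (beta v) = beta (rho x v);
  hrep_bracket : forall x y v,
    rho (br x y) (beta v) = rho (phi x) (rho y v) - rho (phi y) (rho x v)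
}.

End HomLieAlgebra.

Record hom_bundle (R : realType) (n : nat) (M : manifold R n) (r : nat) := HomBundle {
  hom_bundle_bundle :> vbundle M r;
  base_map : smooth_map M M;
  section_map : {linear Gamma(hom_bundle_bundle) -> Gamma(hom_bundle_bundle)};
  section_map_fscale : forall f x,
    section_map (fscale f x) = fscale (pullback base_map f) (section_map x)
}.

Record inv_hom_bundle (R : realType) (n : nat) (M : manifold R n) (r : nat) :=
  InvHomBundle {
  inv_hom_bundle_hom_bundle :> hom_bundle M r;
  base_inv : smooth_map M M;
  base_mapK : cancel (base_map inv_hom_bundle_hom_bundle) base_inv;
  base_invK : cancel base_inv (base_map inv_hom_bundle_hom_bundle);
  section_inv : Gamma(inv_hom_bundle_hom_bundle) -> Gamma(inv_hom_bundle_hom_bundle);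
  section_mapK : cancel (section_map inv_hom_bundle_hom_bundle) section_inv;
  section_invK : cancel section_inv (section_map inv_hom_bundle_hom_bundle)
}.

Section Dagger.
Context {R : realType} {n r : nat} {M : manifold R n}.
Variable A : inv_hom_bundle M r.

(* (dagger w)(X) = phi^*(w(phi_A^-1 X)) for X = X_1 /\ ... /\ X_k. The right-hand
   side is C^oo(M)-multilinear and alternating in the X_i, and a form is
   determined by its values on sections, so exactly one form satisfies this. *)
Definition dagger k (w : kform A k) : kform A k :=
  xget 0 [set w' : kform A k | forall X : 'I_k -> Gamma(A),
    kform_eval w' X = pullback (base_map A) (kform_eval w (fun i => section_inv (X i)))].

Definition dagger_inv k (w : kform A k) : kform A k :=
  xget 0 [set w' : kform A k | dagger w' = w].

End Dagger.

Section HomLieAlgebroid.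
Context {R : realType} {n r : nat} {M : manifold R n}.

Section BundleMap.
Variables (A : vbundle M r) (phi : smooth_map M M).

(* A bundle map from A to the pullback phi^!TM, whose fibre at p is T_(phi p)M.
   A section v of phi^!TM is smooth when p |-> v_p(f) is smooth for all f in
   C^oo(M). *)
Record bundle_map_to_pullback_tangent := BundleMapToPullbackTangent {
  bmap :> forall p, A p -> tangent (phi p);
  bmap_linear : forall p, linear (@bmap p);
  bmap_smooth : forall (x : Gamma(A)) (f : C^oo(M)),
    fun_smooth (fun p => bmap (x p) f)
}.

Definition section_act (a : bundle_map_to_pullback_tangent) (x : Gamma(A))
  (f : C^oo(M)) : C^oo(M) := mk_smooth (bmap_smooth a x f).

End BundleMap.

Variable A : hom_bundle M r.

Definition anchor_map := bundle_map_to_pullback_tangent A (base_map A).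

Record is_hom_lie_algebroid (br : Gamma(A) -> Gamma(A) -> Gamma(A))
    (a : anchor_map) : Prop := HomLieAlgebroid {
  hlad_lie : is_hom_lie_algebra br (section_map A);
  hlad_leibniz : forall (x y : Gamma(A)) (f : C^oo(M)),
    br x (fscale f y) =
      fscale (pullback (base_map A) f) (br x y) +
      fscale (section_act a (section_map A x) f) (section_map A y);
  hlad_rep : is_hom_representation br (section_map A)
    (pullback (base_map A)) (section_act a)
}.

End HomLieAlgebroid.

Definition pairing (R : realType) (n r : nat) (M : manifold R n)
    (A : vbundle M r) (xi : kform A 1) (x : Gamma(A)) : C^oo(M) :=
  kform_eval xi (fun=> x).

(* Main.v *)
(* Since phi_A(f x) = phi^*(f) phi_A(x), the map dagger is a well defined
   automorphism, and with x acting on functions by df(x) the formula for the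
   bracket becomes, for D := dagger,
     (D xi)([x,y]) = - d xi(phi x, phi y) + phi(x)(xi(y)) - phi(y)(xi(x)).
   By the Leibniz rule for d the right-hand side is C^oo(M)-linear in D xi, which
   gives existence of [x,y]; bump functions make 1-forms separate sections, which
   gives uniqueness. The Leibniz rule also gives axiom (i), d D = D d gives
   compatibility with phi, and d^2 f = 0 gives the representation property. For
   Jacobi, d w satisfies the Cartan formula on 2-forms, because the difference of
   the two sides is phi^*-linear in w and vanishes on wedges of 1-forms, which
   locally generate; with w = d xi, d^2 xi = 0 turns it into
     (D D xi)([[x,y],phi z] + cyclic) = 0. *)
Require Import Defs.
From HB Require Import structures.
From mathcomp Require Import all_boot all_order all_algebra all_fingroup.
From mathcomp Require Import all_classical reals.
From mathcomp Require Import topology normedtype landau derive realfun sequences exp.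
From mathcomp Require Import ring lra.
Set Implicit Arguments.
Unset Strict Implicit.
Unset Printing Implicit Defensive.
Import Order.TTheory GRing.Theory Num.Theory.
Import numFieldNormedType.Exports.
Local Open Scope classical_set_scope.
Local Open Scope ring_scope.

(** * Bump functions *)

Section FlatFunction.
Context {R : realType}.
Implicit Types (k : nat) (t : R).

(** All [k] are treated together because the derivative of a member of this family is a combination
    of members. *)
Definition flat k t : R := if 0 < t then t^-1 ^+ k * expR (- t^-1) else 0.

Lemma flat_gt0 k t : 0 < t -> 0 < flat k t.
Proof. by move=> t0; rewrite /flat t0 mulr_gt0 ?expR_gt0 ?exprn_gt0 ?invr_gt0. Qed.

Lemma flat_le0 k t : t <= 0 -> flat k t = 0.
Proof. by move=> t0; rewrite /flat ltNge t0. Qed.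

Lemma flat_ge0 k t : 0 <= flat k t.
Proof. by case: (ltP 0 t) => [/flat_gt0/ltW//|/flat_le0->]. Qed.

(** For [t > 0], put [s = 1/t] and use [exp s >= s^(k+2) / (k+2)!]. The quadratic bound is what
    makes the difference quotient at 0 tend to 0. *)
Lemma flat_quadratic k t : flat k t <= (k.+2)`!%:R * t ^+ 2.
Proof.
case: (ltP 0 t) => t0; last first.
  by rewrite flat_le0// mulr_ge0// sqr_ge0.
rewrite /flat t0 expRN; set s := t^-1.
have s0 : 0 < s by rewrite invr_gt0.
have -> : t = s^-1 by rewrite invrK.
rewrite ler_pdivrMr ?expR_gt0//.
have /(le_trans _) le_exp := expR_ge1Dxn k.+1 (ltW s0).
have /le_exp H : s ^+ k.+2 / (k.+2)`!%:R <= 1 + s ^+ k.+2 / (k.+2)`!%:R.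
  by rewrite lerDr.
rewrite -ler_pdivrMl; last by rewrite mulr_gt0 ?exprn_gt0 ?invr_gt0// ltr0n fact_gt0.
apply: le_trans H; rewrite le_eqVlt; apply/orP; left; apply/eqP.
rewrite !exprS; field.
by rewrite gt_eqF ?ltr0n ?fact_gt0 // gt_eqF.
Qed.

Lemma is_derive_flat k t :
  is_derive t 1 (flat k) (flat k.+2 t - k%:R * flat k.+1 t).
Proof.
have [t0|t0|<-] := ltgtP 0 t.
- apply: (@near_eq_is_derive _ _ _ (fun u : R => u^-1 ^+ k * expR (- u^-1))).
    by apply: filterS (lt_nbhsr t0) => u u0; rewrite /flat u0.
  have tn0 : t != 0 by rewrite gt_eqF.
  have dV := is_deriveV tn0 (is_derive_id t (1:R)).
  have dN := is_deriveN dV.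
  have dE := is_derive1_comp (is_derive_expR _) dN.
  have dX := is_deriveX k dV.
  have XE : (fun u : R => u^-1) ^+ k = (fun u : R => u^-1 ^+ k).
    by apply/funext => u; elim: (k) => // l IH; rewrite !exprS -IH.
  rewrite XE in dX.
  apply: is_derive_eq (is_deriveM dX dE) _.
  rewrite /flat t0 /= /GRing.scale /= mulr1.
  have -> : (- (fun u : R => u^-1)) t = - t^-1 by [].
  by case: (k) => [|l] /=; rewrite ?exprS; field.
- apply: (@near_eq_is_derive _ _ _ (cst 0)).
    by apply: filterS (lt_nbhsl t0) => u u0; rewrite flat_le0// ltW.
  by rewrite !flat_le0 ?(ltW t0)// mulr0 subr0; exact: is_derive_cst.
(* At 0, [flat_quadratic] bounds the difference quotient by [(k+2)! |h|], so the derivative is 0. *)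
- rewrite !flat_le0// mulr0 subr0.
  suff H : h^-1 *: (flat k (h *: 1 + 0) - flat k 0) @[h --> 0^'] --> (0 : R).
    by split; [apply/cvg_ex; exists 0 | exact: cvg_lim].
  apply/cvgr0Pnorm_lt => e e0.
  set c : R := (k.+2)`!%:R.
  have c0 : 0 < c by rewrite ltr0n fact_gt0.
  near=> h.
  have h0 : h != 0 by near: h; exact: nbhs_dnbhs_neq.
  rewrite (flat_le0 _ (lexx 0)) addr0 subr0 /GRing.scale /= mulr1.
  rewrite normrM normfV (ger0_norm (flat_ge0 _ _)) ltr_pdivrMl ?normr_gt0//.
  apply: (le_lt_trans (flat_quadratic _ _)).
  rewrite -/c -real_normK ?num_real// expr2 mulrCA ltr_pM2l ?normr_gt0// mulrC -ltr_pdivlMr//.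
  near: h; apply: dnbhs0_lt; exact: divr_gt0.
Unshelve. all: by end_near.
Qed.

(** Induction on [k] for all [m] at once, since the derivative of [flat m] involves [flat m.+1] and
    [flat m.+2]. *)
Lemma Ck_at_flat n k m (g : 'rV[R]_n -> R) x :
  Ck_at k g x -> Ck_at k (flat m \o g) x.
Proof.
have df l t : differentiable (flat l) t.
  by apply/derivable1_diffP; have [] := is_derive_flat l t.
elim: k m => [|k IH] m.
  rewrite /=; apply: filterS => y gy; apply: continuous_comp => //.
  exact: differentiable_continuous.
move=> Cg; have /IH {}IH := Ck_atW Cg; case: Cg => dg Dg; split.
  by apply: filterS dg => y dg; exact: differentiable_comp.
move=> v; apply: (@Ck_at_near _ _ _ ((fun y => 'D_v g y) \*
  ((flat m.+2 \o g) \+ (cst (- m%:R) \* (flat m.+1 \o g))))); last first.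
  apply: (Ck_atM (Dg v) (Ck_atD (IH _) (Ck_atM _ (IH _)))); exact: Ck_at_cst.
apply: filterS dg => y dg; rewrite [RHS]deriveE; last exact: differentiable_comp.
rewrite diff_comp//= -(deriveE _ dg).
have dflat h : 'd (flat m) (g y) h = h * 'D_1 (flat m) (g y).
  by rewrite deriveE// -[in LHS](mulr1 h) -[h * 1]/(h *: (1 : R)) linearZ.
rewrite dflat (@derive_val _ _ _ _ _ _ _ (is_derive_flat m (g y))).
by rewrite mulNr.
Qed.

End FlatFunction.

(** * Bump functions on a manifold *)

Section Bump.
Context {R : realType} {n : nat} {M : manifold R n}.

Lemma near_chart_dom (i : chart_index M) p :
  chart_dom i p -> \forall q \near p, chart_dom i q.
Proof. by move=> ip; apply: open_nbhs_nbhs; split=> //; exact: chart_dom_open. Qed.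

Lemma fun_smooth_at_chart (i : chart_index M) c p : chart_dom i p ->
  fun_smooth_at (fun q : M => chart i q ord0 c) p.
Proof. by move=> ip j jp; exact: chart_transition_smooth. Qed.

Lemma fun_smooth_at_flat (f : M -> R) p :
  fun_smooth_at f p -> fun_smooth_at (flat 0 \o f) p.
Proof. by move=> sf i ip k; exact: (Ck_at_flat 0 (sf i ip k)). Qed.

Lemma fun_smooth_at_continuous (f : M -> R) p :
  fun_smooth_at f p -> {for p, continuous f}.
Proof.
move=> sf; have [i ip] := chart_cover p.
have cf := nbhs_singleton (sf i ip 0%N).
have fp : f p = ((f \o chart_inv i) \o chart i) p by rewrite /= chartK.
rewrite /prop_for /continuous_at fp.
apply: cvg_trans (continuous_comp (chart_continuous ip) cf); apply: near_eq_cvg.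
by apply: filterS (near_chart_dom ip) => q iq /=; rewrite chartK.
Qed.

(** In a chart around [p], apply [flat 0] to [(e/2)^2] minus the squared Euclidean distance to the
    image of [p], and extend by zero. The last clause expresses that the support lies in [U]. *)
Lemma bump_gt0 (U : set M) p : open U -> U p -> exists f : M -> R,
  [/\ fun_smooth f, 0 < f p & forall q, U q \/ \forall q' \near q, f q' = 0].
Proof.
move=> oU Up; have [i ip] := chart_cover p.
set x := chart i p.
have imx : \forall y \near x, (chart i @` chart_dom i) y /\ U (chart_inv i y).
  apply: filterI.
    by apply: open_nbhs_nbhs; split; [exact: chart_img_open|exists p].
  by apply: (near_chart ip); exact: open_nbhs_nbhs.
have [e /= e0 xe] := (nbhs_ballP _ _).1 imx.
(* This closed cube lies in the ball of radius [e] and contains the chart image of every point where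
   [f] is nonzero. *)
pose box := [set y : 'rV[R]_n | forall c,
  `[x ord0 c - e / 2, x ord0 c + e / 2]%classic (y ord0 c)].
have box_sub y : box y -> (chart i @` chart_dom i) y /\ U (chart_inv i y).
  move=> yb; apply: xe; split=> // a c; rewrite ord1 -ball_normE /=.
  have := yb c; rewrite /= in_itv /= => /andP[y1 y2].
  by rewrite ltr_norml; apply/andP; split; lra.
have cbox : compact (chart_inv i @` box).
  apply: continuous_compact.
    apply: continuous_in_subspaceT => y; rewrite inE => /box_sub [[q iq <-] _].
    exact: chart_inv_continuous.
  by apply: (@rV_compact R n (fun c => `[x ord0 c - e / 2, x ord0 c + e / 2]%classic)) => c;
     exact: segment_compact.
(* The Hausdorff property makes the compact image of the cube closed in [M], so [f] vanishes near
   every point outside it. This is why the extension by zero is smooth. *)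
have clbox := compact_closed (@manifold_hausdorff _ _ M) cbox.
pose g q := (e / 2) ^+ 2 - \sum_c (chart i q ord0 c - x ord0 c) ^+ 2.
pose f q := if `[< chart_dom i q >] then flat 0 (g q) else 0.
have f0 q : ~ (chart_inv i @` box) q -> f q = 0.
  rewrite /f; case: asboolP => // iq nq; apply: flat_le0; rewrite leNgt.
  apply/negP => gq; apply: nq; exists (chart i q); last exact: chartK.
  move=> c /=; rewrite in_itv /=.
  have : (chart i q ord0 c - x ord0 c) ^+ 2 < (e / 2) ^+ 2.
    apply: le_lt_trans (_ : \sum_c (chart i q ord0 c - x ord0 c) ^+ 2 < _).
      rewrite (bigD1 c) //= lerDl; apply: sumr_ge0 => ? _; exact: sqr_ge0.
    by move: gq; rewrite subr_gt0.
  rewrite -(real_normK (num_real (chart i q ord0 c - _))) ltr_pXn2r//; last first.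
    by rewrite nnegrE divr_ge0// ltW.
  by rewrite ltr_norml => /andP[? ?]; apply/andP; split; lra.
exists f; split.
- move=> q.
  have [iq|niq] := pselect (chart_dom i q); last first.
    apply: (@fun_smooth_at_near _ _ _ (fun=> 0)); last exact: fun_smooth_at_cst.
    have : \forall q' \near q, ~ (chart_inv i @` box) q'.
      apply: open_nbhs_nbhs; split; first exact: closed_openC.
      by case=> y /box_sub[[q' iq' <-] _] qq'; apply: niq; rewrite -qq' chartK.
    by apply: filterS => q' /f0.
  apply: (@fun_smooth_at_near _ _ _ (flat 0 \o g)).
    by apply: filterS (near_chart_dom iq) => q' iq'; rewrite /f asboolT.
  apply: fun_smooth_at_flat.
  have -> : g = cst ((e/2)^+2) \+ (cst (-1) \* (fun q => \sum_c
      (((fun q => chart i q ord0 c) \+ cst (- x ord0 c)) q *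
        ((fun q => chart i q ord0 c) \+ cst (- x ord0 c)) q))).
    by apply/funext => q'; rewrite /= mulN1r.
  apply: fun_smooth_atD; first exact: fun_smooth_at_cst.
  apply: fun_smooth_atM; first exact: fun_smooth_at_cst.
  apply: fun_smooth_at_sum => c.
  have H : fun_smooth_at ((fun q => chart i q ord0 c) \+ cst (- x ord0 c)) q.
    apply: fun_smooth_atD; first exact: fun_smooth_at_chart.
    exact: fun_smooth_at_cst.
  exact: fun_smooth_atM.
- rewrite /f asboolT//; apply: flat_gt0; rewrite /g big1.
    by rewrite subr0 exprn_gt0// divr_gt0.
  by move=> c _; rewrite subrr expr0n.
- move=> q; have [[y /box_sub[_ Uy] <-]|nq] := pselect ((chart_inv i @` box) q).
    by left.
  right; have : \forall q' \near q, ~ (chart_inv i @` box) q'.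
    by apply: open_nbhs_nbhs; split; first exact: closed_openC.
  by apply: filterS => q' /f0.
Qed.

Lemma bump_function (U : set M) p : open U -> U p -> exists f : C^oo(M),
  (\forall q \near p, f q = 1) /\
  (forall q, U q \/ \forall q' \near q, f q' = 0).
Proof.
(* 1 - flat(c - f) / flat(c) is 1 where f >= c and 0 where f = 0. *)
move=> oU Up; have [f [sf fp f0]] := bump_gt0 oU Up.
set c := f p / 2; have c0 : 0 < c by rewrite divr_gt0.
pose g := cst 1 \+ (cst (- (flat 0 c)^-1) \* (flat 0 \o (cst c \+ (cst (-1) \* f)))).
have sg : fun_smooth g.
  move=> q; apply: fun_smooth_atD; first exact: fun_smooth_at_cst.
  apply: fun_smooth_atM; first exact: fun_smooth_at_cst.
  apply: fun_smooth_at_flat; apply: fun_smooth_atD; first exact: fun_smooth_at_cst.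
  by apply: fun_smooth_atM (sf q); exact: fun_smooth_at_cst.
exists (mk_smooth sg); split=> [|q]; last first.
  have [|fq] := f0 q; [by left|right]; apply: filterS fq => q' fq'.
  rewrite /= /g/= fq' mulr0 addr0 mulNr mulVf ?subrr//.
  by rewrite gt_eqF// flat_gt0.
have cf := fun_smooth_at_continuous (sf p).
have : \forall q \near p, c < f q.
  by apply: (cvgr_gt _ cf); rewrite /c; lra.
apply: filterS => q /ltW cq; rewrite /= /g/= mulN1r.
by rewrite (@flat_le0 _ _ (_ - _)) ?subr_le0// mulr0 addr0.
Qed.

End Bump.

(** * Tensoriality *)

Section Pointwise.
Context {R : realType} {n r : nat} {M : manifold R n} {A : vbundle M r}.
Implicit Types (f g : C^oo(M)) (x y : Gamma(A)) (p : M).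

Lemma smooth_eq f g : (forall p, f p = g p) -> f = g.
Proof. by move=> fg; apply: val_inj; apply/funext. Qed.

Lemma section_eq x y : (forall p, x p = y p) -> x = y.
Proof. by move=> xy; apply: val_inj; apply/functional_extensionality_dep. Qed.

Lemma kform_eq k (w z : kform A k) : (forall p v, w p v = z p v) -> w = z.
Proof.
move=> wz; apply: val_inj; apply/functional_extensionality_dep => p.
by apply/funext => v; exact: wz.
Qed.

Lemma smoothD f g p : (f + g) p = f p + g p. Proof. by []. Qed.
Lemma smoothM f g p : (f * g) p = f p * g p. Proof. by []. Qed.
Lemma smoothN f p : (- f) p = - f p. Proof. by []. Qed.
Lemma smoothZ c f p : (c *: f) p = c * f p. Proof. by []. Qed.
Lemma smooth1 p : (1 : C^oo(M)) p = 1. Proof. by []. Qed.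
Lemma sectionD x y p : (x + y) p = x p + y p. Proof. by []. Qed.
Lemma sectionN x p : (- x) p = - x p. Proof. by []. Qed.
Lemma sectionZ c x p : (c *: x) p = c *: x p. Proof. by []. Qed.
Lemma section0 p : (0 : Gamma(A)) p = 0. Proof. by []. Qed.
Lemma fscaleE f x p : fscale f x p = f p *: x p. Proof. by []. Qed.
Lemma kformD k (w z : kform A k) p v : (w + z) p v = w p v + z p v. Proof. by []. Qed.
Lemma smooth_sum (I : Type) (s : seq I) (F : I -> C^oo(M)) p :
  (\sum_(i <- s) F i) p = \sum_(i <- s) F i p.
Proof. by elim: s => [|i s IH]; rewrite ?big_nil// !big_cons smoothD IH. Qed.
Lemma section_sum (I : Type) (s : seq I) (F : I -> Gamma(A)) p :
  (\sum_(i <- s) F i) p = \sum_(i <- s) F i p.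
Proof. by elim: s => [|i s IH]; rewrite ?big_nil// !big_cons sectionD IH. Qed.
Lemma kform_sum (I : Type) (s : seq I) k (F : I -> kform A k) p v :
  (\sum_(i <- s) F i) p v = \sum_(i <- s) F i p v.
Proof. by elim: s => [|i s IH]; rewrite ?big_nil// !big_cons kformD IH. Qed.

(** Reduces linearity over [R] to linearity over functions. *)
Lemma scale_fscale (c : R) x : c *: x = fscale (c *: (1 : C^oo(M))) x.
Proof. by apply: section_eq => p; rewrite fscaleE smoothZ smooth1 mulr1. Qed.

Lemma kfscale_subproof k f (w : kform A k) :
  ((fun p v => f p * w p v) : dfun (kform_fibre A k)) \in @kform_pred _ _ _ _ A k.
Proof.
rewrite inE /= => p; split.
- by move=> i v a u u'; rewrite kform_multilinear; ring.
- by move=> v i i' ii' vi; rewrite (kform_alternating w ii' vi) mulr0.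
- move=> j s jp; apply: fun_smooth_atM; first exact: smooth_val_smooth.
  exact: (kform_smooth w s jp).
Qed.

Definition kfscale k f (w : kform A k) : kform A k := KForm (kfscale_subproof f w).

Lemma kfscaleE k f (w : kform A k) p v : kfscale f w p v = f p * w p v.
Proof. by []. Qed.

End Pointwise.

(** * Cut-off local frames and coframes *)

Section LocalFrame.
Context {R : realType} {n r : nat} {M : manifold R n} (A : vbundle M r).

Lemma near_triv_dom (j : triv_index A) p :
  triv_dom j p -> \forall q \near p, triv_dom j q.
Proof. by move=> jp; apply: open_nbhs_nbhs; split=> //; exact: triv_dom_open. Qed.

(** Outside [triv_dom j] the value of [frame] is arbitrary, but [f] vanishes near such points, so
    the product is a global smooth section. *)
Lemma cut_frame (j : triv_index A) (f : C^oo(M)) b :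
  (forall q, triv_dom j q \/ \forall q' \near q, f q' = 0) ->
  exists u : Gamma(A), forall q, u q = f q *: frame j q b.
Proof.
move=> fj.
suff H : ((fun q => f q *: frame j q b) : dfun A) \in @section_pred _ _ _ _ A.
  by exists (SmoothSection H).
rewrite inE /= => p j' jp c; have [jjp|fp] := fj p; last first.
  apply: (@fun_smooth_at_near _ _ _ (fun=> 0)); last exact: fun_smooth_at_cst.
  apply: filterS2 fp (near_triv_dom jp) => q fq jq.
  by rewrite fq scale0r triv0// mxE.
apply: (@fun_smooth_at_near _ _ _ (f \* (fun q => triv j' (frame j q b) ord0 c))).
  apply: filterS (near_triv_dom jp) => q jq /=.
  have := triv_linear jq (f q) (frame j q b) 0.
  by rewrite triv0// !addr0 => ->; rewrite mxE.
by apply: fun_smooth_atM; [exact: smooth_val_smooth|exact: triv_transition_smooth].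
Qed.

Lemma cut_coframe (j : triv_index A) (f : C^oo(M)) b :
  (forall q, triv_dom j q \/ \forall q' \near q, f q' = 0) ->
  exists e : kform A 1, forall q v, e q v = f q * triv j (v ord0) ord0 b.
Proof.
move=> fj.
suff H : ((fun q v => f q * triv j (v ord0) ord0 b) : dfun (kform_fibre A 1))
    \in @kform_pred _ _ _ _ A 1.
  by exists (KForm H).
rewrite inE /= => p; split.
- move=> i v a u u'; rewrite (ord1 i) /upd /=.
  have [jp|/nbhs_singleton fp] := fj p; last by rewrite fp; ring.
  by rewrite triv_linear// !mxE /=; ring.
- by move=> v i i'; rewrite (ord1 i) (ord1 i') eqxx.
- move=> j' s jp; have [jjp|fp] := fj p; last first.
    apply: (@fun_smooth_at_near _ _ _ (fun=> 0)); last exact: fun_smooth_at_cst.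
    by apply: filterS fp => q fq; rewrite fq mul0r.
  by apply: fun_smooth_atM; [exact: smooth_val_smooth|exact: triv_transition_smooth].
Qed.

(** Global objects that replace a frame and its dual coframe near [p]. Both carry a factor [f],
    hence the [f ^+ 2] in the expansion, which then holds on all of [M] and can be applied to global
    sections. *)
Lemma local_frame (j : triv_index A) p : triv_dom j p ->
  exists (f : C^oo(M)) (u : 'I_r -> Gamma(A)) (e : 'I_r -> kform A 1),
  [/\ \forall q \near p, f q = 1,
      forall q b, u b q = f q *: frame j q b,
      forall q b v, e b q v = f q * triv j (v ord0) ord0 b &
      forall q (v : A q), f q ^+ 2 *: v = \sum_b e b q (fun=> v) *: u b q].
Proof.
move=> jp; have [f [fp fj]] := bump_function (@triv_dom_open _ _ _ _ _ j) jp.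
have /choice[u uE] b := cut_frame b fj.
have /choice[e eE] b := cut_coframe b fj.
exists f, u, e; split=> // q v.
have [jq|/nbhs_singleton fq] := fj q; last first.
  by rewrite fq expr0n scale0r big1// => b _; rewrite uE fq scale0r scaler0.
rewrite {1}(frameE v jq) scaler_sumr; apply: eq_bigr => b _.
by rewrite eE uE !scalerA; congr (_ *: _); ring.
Qed.

End LocalFrame.

(** * Function-linear maps on sections come from forms *)

Section Tensoriality.
Context {R : realType} {n r : nat} {M : manifold R n} {A : vbundle M r}.

Definition tensorial k (F : ('I_k -> Gamma(A)) -> C^oo(M)) : Prop :=
  forall X i f u u',
    F (upd X i (fscale f u + u')) = f * F (upd X i u) + F (upd X i u').

Lemma tensorial0 k F X i : @tensorial k F -> F (upd X i 0) = 0.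
Proof.
move=> Ft; have := Ft X i 1 0 0.
rewrite (_ : fscale 1 0 + 0 = 0).
  by rewrite mul1r => /eqP; rewrite -subr_eq0 opprD addrA subrr add0r oppr_eq0 => /eqP.
by apply: section_eq => q; rewrite sectionD fscaleE scale1r section0 addr0.
Qed.

Lemma tensorialZ k F X i f u : @tensorial k F ->
  F (upd X i (fscale f u)) = f * F (upd X i u).
Proof. by move=> Ft; have := Ft X i f u 0; rewrite addr0 tensorial0// addr0. Qed.

Lemma tensorialD k F X i u u' : @tensorial k F ->
  F (upd X i (u + u')) = F (upd X i u) + F (upd X i u').
Proof.
move=> Ft; have := Ft X i 1 u u'; rewrite mul1r => <-; congr (F (upd X i (_ + _))).
by apply: section_eq => q; rewrite fscaleE scale1r.
Qed.

Lemma tensorial_sum k F X i (I : Type) (s : seq I) (c : I -> C^oo(M)) u :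
  @tensorial k F ->
  F (upd X i (\sum_(b <- s) fscale (c b) (u b))) =
  \sum_(b <- s) c b * F (upd X i (u b)).
Proof.
move=> Ft; elim: s => [|b s IH]; first by rewrite !big_nil tensorial0.
by rewrite !big_cons Ft IH.
Qed.

Lemma kform1_sum (xi : kform A 1) p (I : Type) (s : seq I) (c : I -> R) (v : I -> A p) :
  xi p (fun=> \sum_(b <- s) c b *: v b) = \sum_(b <- s) c b * xi p (fun=> v b).
Proof.
have E (u : A p) : (fun=> u) = upd (fun=> u) (ord0 : 'I_1) u.
  by apply/funext => i; rewrite /upd ord1.
have F (u u' : A p) : upd (fun=> u') (ord0 : 'I_1) u = (fun=> u).
  by apply/funext => i; rewrite /upd ord1.
rewrite E multilinear_sum; last exact: kform_multilinear.
by apply: eq_bigr => b _; rewrite F.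
Qed.

(** The section [fscale (f ^+ 2) u] is a combination of the global sections [v b] with coefficients
    that vanish at [p], and [f p = 1] removes the factor. *)
Lemma tensorial_vanish k F X i (u : Gamma(A)) p : @tensorial k F ->
  u p = 0 -> F (upd X i u) p = 0.
Proof.
move=> Ft up; have [j jp] := triv_cover A p.
have [f [v [e [/nbhs_singleton fp _ _ fve]]]] := local_frame jp.
have : F (upd X i (fscale (f ^+ 2) u)) p = 0.
  rewrite (_ : fscale _ _ = \sum_b fscale (kform_eval (e b) (fun=> u)) (v b)).
    rewrite tensorial_sum// smooth_sum big1// => b _.
    (* That [e b] kills the zero vector is [kform1_sum] for an empty sum. *)
    rewrite smoothM /= up; have := kform1_sum (e b) [::] (fun _ : unit => 0) (fun=> 0 : A p).
    by rewrite !big_nil => ->; rewrite mul0r.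
  apply: section_eq => q; rewrite fscaleE section_sum.
  by rewrite -[(f ^+ 2) q]/(f q ^+ 2) fve.
by rewrite tensorialZ// smoothM -[(f ^+ 2) p]/(f p ^+ 2) fp expr1n mul1r.
Qed.

(** The arguments are exchanged one at a time; each exchange changes the value by a term with an
    argument vanishing at [p]. *)
Lemma tensorial_local k F (X Y : 'I_k -> Gamma(A)) p : @tensorial k F ->
  (forall i, X i p = Y i p) -> F X p = F Y p.
Proof.
move=> Ft XY; pose Z l (i : 'I_k) := if (i < l)%N then Y i else X i.
suff H l : (l <= k)%N -> F X p = F (Z l) p.
  by rewrite (H _ (leqnn k)); congr (F _ p); apply/funext => i; rewrite /Z ltn_ord.
elim: l => // l IH lk; rewrite (IH (ltnW lk)); pose i := Ordinal lk.
have -> : Z l = upd (Z l) i ((X i - Y i) + Y i).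
  apply/funext => i'; rewrite /upd subrK; case: eqP => // ->.
  by rewrite /Z ltnn.
have -> : Z l.+1 = upd (Z l) i (Y i).
  apply/funext => i'; rewrite /upd; case: eqP => [->|/eqP ii'].
    by rewrite /Z ltnSn.
  by rewrite /Z ltnS leq_eqVlt -[(i' == l :> nat)]/(i' == i) (negPf ii').
rewrite tensorialD// smoothD tensorial_vanish ?add0r//.
by rewrite sectionD sectionN XY subrr.
Qed.

Lemma section_through p (v : A p) : exists x : Gamma(A), x p = v.
Proof.
have [j jp] := triv_cover A p.
have [f [u [e [/nbhs_singleton fp _ _ fue]]]] := local_frame jp.
exists (\sum_b e b p (fun=> v) *: u b).
rewrite section_sum -[RHS]scale1r -(expr1n _ 2) -fp fue.
by apply: eq_bigr => b _; rewrite sectionZ.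
Qed.

(** The form at [p] is evaluated by extending the vectors to global sections; by [tensorial_local]
    the choice of extensions is irrelevant. *)
Lemma tensorial_kform k F : @tensorial k F ->
  (forall X i j, i != j -> X i = X j -> F X = 0) ->
  exists w : kform A k, forall X, kform_eval w X = F X.
Proof.
move=> Ft Fa.
have /choice[ext extE] (pv : {p : M & A p}) := section_through (projT2 pv).
pose X p (v : 'I_k -> A p) i := ext (existT _ p (v i)).
have XE p v i : @X p v i p = v i by rewrite [LHS]extE.
pose w : dfun (kform_fibre A k) := fun p v => F (X p v) p.
have wE p v (Y : 'I_k -> Gamma(A)) : (forall i, Y i p = v i) -> w p v = F Y p.
  by move=> Yv; apply: tensorial_local => // i; rewrite XE Yv.
suff H : w \in kform_pred A k.
  by exists (KForm H) => Y; apply: smooth_eq => p; exact: wE.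
rewrite inE /= => p; split.
- move=> i v a u u'.
  have updE (t : A p) (y : Gamma(A)) : y p = t ->
      w p (upd v i t) = F (upd (X p v) i y) p.
    by move=> yt; apply: wE => i'; rewrite /upd; case: eqP => // _; exact: XE.
  rewrite (updE _ (a *: ext (existT _ p u) + ext (existT _ p u'))); last first.
    by rewrite sectionD sectionZ !extE.
  rewrite (updE _ _ (extE (existT _ p u))) (updE _ _ (extE (existT _ p u'))).
  rewrite tensorialD// smoothD; congr (_ + _).
  rewrite scale_fscale.
  by rewrite tensorialZ// smoothM smoothZ smooth1 mulr1.
- move=> v i i' ii' vi; rewrite /w (Fa _ _ _ ii')//.
  by rewrite /X vi.
(* Near [p] the frame vectors are values of the global sections [u (s i)], so the coefficient agrees
   there with a smooth function. *)
- move=> j s jp; have [f [u [e [fp uE _ _]]]] := local_frame jp.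
  apply: (@fun_smooth_at_near _ _ _ (F (fun i => u (s i)))); last first.
    exact: smooth_val_smooth.
  apply: filterS fp => q fq; apply/esym/wE => i.
  by rewrite uE fq scale1r.
Qed.

Lemma kform_eval_tensorial k (w : kform A k) : tensorial (kform_eval w).
Proof.
move=> X i f u u'; apply: smooth_eq => p; rewrite smoothD smoothM /=.
have E y : (fun i' => upd X i y i' p) = upd (fun i' => X i' p) i (y p).
  by apply/funext => i'; rewrite /upd; case: eqP.
by rewrite !E sectionD fscaleE kform_multilinear.
Qed.

Lemma kform_ext k (w z : kform A k) :
  (forall X, kform_eval w X = kform_eval z X) -> w = z.
Proof.
move=> wz; apply: kform_eq => p v.
have /choice[X XE] i := section_through (v i).
have := congr1 (fun f : C^oo(M) => f p) (wz X); rewrite /=.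
by have -> : (fun i => X i p) = v by apply/funext.
Qed.

(** At each point, the forms [e b] of a cut-off coframe already separate the vectors of the
    fibre. *)
Lemma pairing_sep (x y : Gamma(A)) :
  (forall xi : kform A 1, pairing xi x = pairing xi y) -> x = y.
Proof.
move=> xy; apply: section_eq => p; have [j jp] := triv_cover A p.
have [f [u [e [/nbhs_singleton fp _ _ fue]]]] := local_frame jp.
rewrite -[x p]scale1r -[y p]scale1r -(expr1n _ 2) -fp !fue.
apply: eq_bigr => b _; congr (_ *: _).
exact: (congr1 (fun f : C^oo(M) => f p) (xy (e b))).
Qed.

(* The bundle [A] is the dual of its dual. *)
Lemma section_of_functional (L : kform A 1 -> C^oo(M)) :
  (forall xi zeta, L (xi + zeta) = L xi + L zeta) ->
  (forall f xi, L (kfscale f xi) = f * L xi) ->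
  exists x : Gamma(A), forall xi, pairing xi x = L xi.
Proof.
move=> LD LZ.
have L0 : L 0 = 0.
  by have /eqP := LD 0 0; rewrite addr0 -subr_eq0 opprD addrA subrr add0r oppr_eq0 => /eqP.
have LS (s : seq 'I_r) (F : 'I_r -> kform A 1) :
    L (\sum_(b <- s) F b) = \sum_(b <- s) L (F b).
  by elim: s => [|b s IH]; rewrite ?big_nil// !big_cons LD IH.
have pt p : exists v : A p, forall xi : kform A 1, xi p (fun=> v) = L xi p.
  have [j jp] := triv_cover A p.
  have [f [u [e [/nbhs_singleton fp _ _ fue]]]] := local_frame jp.
  (* This vector is forced: [f^2 xi] is the sum of the [xi(u b) e b], to which [L] is applied at
     [p]. *)
  exists (\sum_b L (e b) p *: u b p) => xi.
  have : L (kfscale (f ^+ 2) xi) p = L xi p.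
    by rewrite LZ smoothM -[(f ^+ 2) p]/(f p ^+ 2) fp expr1n mul1r.
  rewrite (_ : kfscale _ _ = \sum_b kfscale (pairing xi (u b)) (e b)).
    rewrite LS smooth_sum => <-; rewrite kform1_sum.
    by apply: eq_bigr => b _; rewrite LZ smoothM mulrC.
  apply: kform_eq => q v; rewrite kform_sum kfscaleE -[(f ^+ 2) q]/(f q ^+ 2).
  have -> : v = (fun=> v ord0) by apply/funext => i; rewrite ord1.
  have := fue q (v ord0); move: (v ord0) => {}v fv.
  transitivity (xi q (fun=> f q ^+ 2 *: v)).
    have := @kform1_sum xi q _ [:: tt] (fun=> f q ^+ 2) (fun=> v).
    by rewrite !big_seq1.
  rewrite fv kform1_sum; apply: eq_bigr => b _.
  by rewrite kfscaleE mulrC.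
pose x p := sval (cid (pt p)).
have xE p (xi : kform A 1) : xi p (fun=> x p) = L xi p.
  by rewrite /x; case: cid.
suff H : (x : dfun A) \in @section_pred _ _ _ _ A.
  by exists (SmoothSection H) => xi; apply: smooth_eq => p; exact: xE.
(* Near [p], where [f] is 1, coordinate [b] of [x] is the smooth function [L (e b)]. *)
rewrite inE /= => p j jp b; have [f [u [e [fp _ eE _]]]] := local_frame jp.
apply: (@fun_smooth_at_near _ _ _ (L (e b))); last exact: smooth_val_smooth.
by apply: filterS fp => q fq; rewrite -xE eE fq mul1r.
Qed.

End Tensoriality.

(** * Wedge products in low degree *)

Section PermutationSums.
Context {R : comPzRingType}.

(** A permutation is encoded by the image of 0 and a permutation of the remaining points. The
    encoding is injective, and counting makes it bijective. *)
Lemma sum_perm_recl n (F : 'S_n.+1 -> R) :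
  \sum_s F s = \sum_i \sum_(t : 'S_n) F (lift_perm ord0 i t).
Proof.
pose h (it : 'I_n.+1 * 'S_n) := lift_perm ord0 it.1 it.2.
have h_inj : injective h.
  move=> [i t] [j u] htu.
  have ij : i = j by have := congr1 (fun s : 'S_n.+1 => s ord0) htu; rewrite !lift_perm_id.
  subst j; congr (_, _); apply/permP => k; apply: (@lift_inj _ i).
  by rewrite -!(lift_perm_lift ord0) -/(h (i, t)) htu.
have [h' hK h'K] : bijective h.
  by apply: inj_card_bij h_inj _; rewrite card_prod !card_Sn card_ord factS.
rewrite pair_bigA (reindex h) //; by exists h' => ? _.
Qed.

Lemma sum_perm0 (F : 'S_0 -> R) : \sum_s F s = F 1%g.
Proof.
rewrite (bigD1 1%g)//= big1 ?addr0// => s /eqP[].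
by apply/permP => -[].
Qed.

Lemma sum_perm2 (G : 'I_2 -> 'I_2 -> R) :
  \sum_(s : 'S_2) (-1) ^+ s * G (s ord0) (s (lift ord0 ord0)) =
  G ord0 (lift ord0 ord0) - G (lift ord0 ord0) ord0.
Proof.
rewrite sum_perm_recl !big_ord_recl big_ord0 !sum_perm_recl !big_ord_recl !big_ord0.
rewrite !sum_perm0 !lift_perm_lift !lift_perm_id !odd_lift_perm odd_perm1 /=.
have -> : lift (lift ord0 ord0) ord0 = ord0 :> 'I_2 by apply: val_inj.
by ring.
Qed.

Lemma sum_perm3 (G : 'I_3 -> 'I_3 -> 'I_3 -> R) :
  let i0 := ord0 : 'I_3 in let i1 := lift ord0 ord0 : 'I_3 in
  let i2 := lift ord0 (lift ord0 ord0) : 'I_3 in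
  \sum_(s : 'S_3) (-1) ^+ s * G (s i0) (s i1) (s i2) =
  G i0 i1 i2 - G i0 i2 i1 + (G i1 i2 i0 - G i1 i0 i2) + (G i2 i0 i1 - G i2 i1 i0).
Proof.
move=> i0 i1 i2; rewrite sum_perm_recl !big_ord_recl big_ord0 !sum_perm_recl.
rewrite !big_ord_recl !big_ord0 !sum_perm_recl !big_ord_recl !big_ord0.
rewrite !sum_perm0 !lift_perm_lift !lift_perm_id !odd_lift_perm odd_perm1 /=.
rewrite -/i0 -/i1 -/i2.
have E0 : lift i1 ord0 = i0 by apply: val_inj.
have E1 : lift i1 (lift ord0 ord0) = i2 by apply: val_inj.
have E2 : lift i2 ord0 = i0 by apply: val_inj.
have E3 : lift i2 (lift ord0 ord0) = i1 by apply: val_inj.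
have -> : lift (lift ord0 ord0) ord0 = ord0 :> 'I_2 by apply: val_inj.
by rewrite E0 E1 E2 E3; ring.
Qed.

End PermutationSums.

Section Alternating2.
Context {R : realType} {V : lmodType R}.

Lemma upd_pairl (x y u : V) : upd (tnth [tuple x; y]) ord0 u = tnth [tuple u; y].
Proof. by apply/funext => -[[|[|//]] ?]. Qed.

Lemma upd_pairr (x y u : V) : upd (tnth [tuple x; y]) ord_max u = tnth [tuple x; u].
Proof. by apply/funext => -[[|[|//]] ?]. Qed.

End Alternating2.

(** * Evaluation of forms of degree at most three *)

Section Forms2.
Context {R : realType} {n r : nat} {M : manifold R n} {A : vbundle M r}.
Implicit Types (x y z : Gamma(A)) (f g : C^oo(M)).

Definition ev2 (w : kform A 2) x y : C^oo(M) := kform_eval w (tnth [tuple x; y]).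
Definition ev3 (w : kform A 3) x y z : C^oo(M) := kform_eval w (tnth [tuple x; y; z]).

Lemma pairing_linear (xi : kform A 1) f x y :
  pairing xi (fscale f x + y) = f * pairing xi x + pairing xi y.
Proof.
have E (u : Gamma(A)) : (fun=> u) = upd (fun=> 0) (ord0 : 'I_1) u.
  by apply/funext => i; rewrite /upd ord1.
by rewrite /pairing (E (fscale f x + y)) (E x) (E y); exact: kform_eval_tensorial.
Qed.

Lemma ev2_linearl (w : kform A 2) f x y z :
  ev2 w (fscale f x + y) z = f * ev2 w x z + ev2 w y z.
Proof.
have E u : tnth [tuple u; z] = upd (tnth [tuple 0; z]) ord0 u by rewrite upd_pairl.
by rewrite /ev2 (E (_ + _)) (E x) (E y); exact: kform_eval_tensorial.
Qed.

Lemma ev2_linearr (w : kform A 2) f x y z :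
  ev2 w z (fscale f x + y) = f * ev2 w z x + ev2 w z y.
Proof.
have E u : tnth [tuple z; u] = upd (tnth [tuple z; 0]) ord_max u by rewrite upd_pairr.
by rewrite /ev2 (E (_ + _)) (E x) (E y); exact: kform_eval_tensorial.
Qed.

Lemma ev2_alt (w : kform A 2) x : ev2 w x x = 0.
Proof.
apply: smooth_eq => p; apply: (@kform_alternating _ _ _ _ _ _ w p _ ord0 ord_max) => //.
Qed.

(** Polarization of [w(x + y, x + y) = 0]. *)
Lemma ev2_skew (w : kform A 2) x y : ev2 w x y = - ev2 w y x.
Proof.
apply/eqP; rewrite -addr_eq0; apply/eqP.
have := ev2_alt w (fscale 1 x + y).
rewrite ev2_linearl !ev2_linearr !ev2_alt => <-; ring.
Qed.

Lemma pairing_fscale (xi : kform A 1) f x : pairing xi (fscale f x) = f * pairing xi x.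
Proof.
have E (u : Gamma(A)) : (fun=> u) = upd (fun=> 0) (ord0 : 'I_1) u.
  by apply/funext => i; rewrite /upd ord1.
by rewrite /pairing (E (fscale f x)) (E x); apply: tensorialZ; exact: kform_eval_tensorial.
Qed.

Lemma ev2_fscalel (w : kform A 2) f x z : ev2 w (fscale f x) z = f * ev2 w x z.
Proof.
have E u : tnth [tuple u; z] = upd (tnth [tuple 0; z]) ord0 u by rewrite upd_pairl.
by rewrite /ev2 (E (fscale f x)) (E x); apply: tensorialZ; exact: kform_eval_tensorial.
Qed.

Lemma ev2_fscaler (w : kform A 2) f x z : ev2 w z (fscale f x) = f * ev2 w z x.
Proof. by rewrite ev2_skew ev2_fscalel ev2_skew mulrN opprK. Qed.

Lemma wedge11 (xi zeta : kform A 1) x y :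
  ev2 (kwedge xi zeta) x y =
  pairing xi x * pairing zeta y - pairing xi y * pairing zeta x.
Proof.
apply: smooth_eq => p; rewrite smoothD smoothN !smoothM.
rewrite -[LHS]/((1`! * 1`!)%:R^-1 * \sum_(s : 'S_2) (-1) ^+ s *
   (xi p (fun i => tnth [tuple x; y] (s (lshift 1 i)) p) *
    zeta p (fun i => tnth [tuple x; y] (s (rshift 1 i)) p))).
rewrite invr1 mul1r.
pose G (i j : 'I_2) := xi p (fun=> tnth [tuple x; y] i p) * zeta p (fun=> tnth [tuple x; y] j p).
rewrite -[RHS](sum_perm2 G); apply: eq_bigr => s _; congr (_ * (_ * _)).
  by congr (kform_at xi _); apply/funext => i; rewrite ord1;
     congr (section_at (tnth _ (s _)) p); apply: val_inj.
by congr (kform_at zeta _); apply/funext => i; rewrite ord1;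
   congr (section_at (tnth _ (s _)) p); apply: val_inj.
Qed.

(** The six permutation terms agree in pairs by skew-symmetry of [w], which cancels the factor
    [1/2!]. *)
Lemma wedge12 (xi : kform A 1) (w : kform A 2) x y z :
  ev3 (kwedge xi w) x y z =
  pairing xi x * ev2 w y z + pairing xi y * ev2 w z x + pairing xi z * ev2 w x y.
Proof.
apply: smooth_eq => p; rewrite !smoothD !smoothM.
rewrite -[LHS]/((1`! * 2`!)%:R^-1 * \sum_(s : 'S_3) (-1) ^+ s *
   (xi p (fun i => tnth [tuple x; y; z] (s (lshift 2 i)) p) *
    w p (fun i => tnth [tuple x; y; z] (s (rshift 1 i)) p))).
pose t := tnth [tuple x; y; z].
pose G (i j k : 'I_3) := pairing xi (t i) p * ev2 w (t j) (t k) p.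
transitivity (2%:R^-1 * \sum_(s : 'S_3) (-1) ^+ s *
   G (s ord0) (s (lift ord0 ord0)) (s (lift ord0 (lift ord0 ord0)))).
  congr (_ * _); apply: eq_bigr => s _; congr (_ * (_ * _)).
    by congr (kform_at xi _); apply/funext => i; rewrite ord1;
       congr (section_at (tnth _ (s _)) p); apply: val_inj.
  congr (kform_at w _); apply/funext => -[[|[|//]] ?] /=;
    congr (section_at (tnth _ (s _)) p); exact: val_inj.
have [t0 t1 t2] : [/\ t ord0 = x, t (lift ord0 ord0) = y &
  t (lift ord0 (lift ord0 ord0)) = z] by [].
rewrite sum_perm3 /G t0 t1 t2.
rewrite (ev2_skew w x z) (ev2_skew w y x) (ev2_skew w z y) !smoothN.
by field.
Qed.

End Forms2.

(** * The dagger map and the differential *)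

Section EvalLinear.
Context {R : realType} {n r : nat} {M : manifold R n} {A : vbundle M r}.
Variables (k : nat) (X : 'I_k -> Gamma(A)).
Implicit Types w z : kform A k.

Lemma kform_evalD w z : kform_eval (w + z) X = kform_eval w X + kform_eval z X.
Proof. exact: smooth_eq. Qed.

Lemma kform_evalB w z : kform_eval (w - z) X = kform_eval w X - kform_eval z X.
Proof. exact: smooth_eq. Qed.

Lemma kform_evalZ c w : kform_eval (c *: w) X = c *: kform_eval w X.
Proof. exact: smooth_eq. Qed.

Lemma kform_eval_kfscale f w : kform_eval (kfscale f w) X = f * kform_eval w X.
Proof. exact: smooth_eq. Qed.

End EvalLinear.

(** * The dagger map and its inverse *)

Section DaggerTheory.
Context {R : realType} {n r : nat} {M : manifold R n} (A : inv_hom_bundle M r).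
Local Notation C := C^oo(M).
Local Notation phi := (base_map A).
Local Notation Phi := (section_map A).
Local Notation Phi' := (@section_inv _ _ _ _ A).
Implicit Types (x y z : Gamma(A)) (f g : C).

Lemma pullbackE (psi : smooth_map M M) f p : pullback psi f p = f (psi p).
Proof. by []. Qed.

Lemma pullbackD (psi : smooth_map M M) f g :
  pullback psi (f + g) = pullback psi f + pullback psi g.
Proof. exact: smooth_eq. Qed.

Lemma pullbackM (psi : smooth_map M M) f g :
  pullback psi (f * g) = pullback psi f * pullback psi g.
Proof. exact: smooth_eq. Qed.

Lemma base_map_pullbackK : cancel (pullback (base_inv A)) (pullback phi).
Proof. by move=> f; apply: smooth_eq => p; rewrite !pullbackE base_mapK. Qed.

Lemma base_inv_pullbackK : cancel (pullback phi) (pullback (base_inv A)).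
Proof. by move=> f; apply: smooth_eq => p; rewrite !pullbackE base_invK. Qed.

Lemma section_inv_linear f x y :
  Phi' (fscale f x + y) = fscale (pullback (base_inv A) f) (Phi' x) + Phi' y.
Proof.
apply: (can_inj (@section_mapK _ _ _ _ A)).
by rewrite linearD section_map_fscale !section_invK base_map_pullbackK.
Qed.

(** Since [dagger] is defined by choice, a form with these values has to be shown to exist. The
    inverse of [Phi] pulls coefficients back along [base_inv] and the outer pullback undoes this, so
    the right-hand side is tensorial. *)
Lemma dagger_eval k (w : kform A k) (X : 'I_k -> Gamma(A)) :
  kform_eval (dagger w) X = pullback phi (kform_eval w (fun i => Phi' (X i))).
Proof.
rewrite /dagger; case: xgetP => [w' -> /(_ X)//|].
suff [w' w'E] : exists w' : kform A k, forall X : 'I_k -> Gamma(A),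
    kform_eval w' X = pullback phi (kform_eval w (fun i => Phi' (X i))).
  by move=> /(_ w') /(_ w'E).
apply: tensorial_kform => [Y i f u u'|Y i j ij Yij].
  have E y : (fun j => Phi' (upd Y i y j)) = upd (fun j => Phi' (Y j)) i (Phi' y).
    by apply/funext => j; rewrite /upd; case: eqP.
  rewrite !E section_inv_linear kform_eval_tensorial pullbackD pullbackM.
  by rewrite base_map_pullbackK.
apply: smooth_eq => p; rewrite pullbackE.
by apply: (kform_alternating w ij); rewrite Yij.
Qed.

Lemma dagger_inj k : injective (@dagger _ _ _ _ A k).
Proof.
move=> w z wz; apply: kform_ext => X.
have := congr1 (fun w => kform_eval w (fun i => Phi (X i))) wz.
rewrite !dagger_eval => /(can_inj base_inv_pullbackK).
by have -> : (fun i => Phi' (Phi (X i))) = X by apply/funext => i; rewrite section_mapK.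
Qed.

(** The preimage is explicit: its value on [X] is the pullback along [base_inv] of the value of [w]
    on the sections [Phi (X i)]. *)
Lemma dagger_invK k (w : kform A k) : dagger (dagger_inv w) = w.
Proof.
rewrite /dagger_inv; case: xgetP => [w' -> //|].
suff [w' w'E] : exists w' : kform A k, forall X : 'I_k -> Gamma(A),
    kform_eval w' X = pullback (base_inv A) (kform_eval w (fun i => Phi (X i))).
  move=> /(_ w') []; apply: kform_ext => X; rewrite dagger_eval w'E.
  rewrite base_map_pullbackK; congr kform_eval.
  by apply/funext => i; rewrite section_invK.
apply: tensorial_kform => [Y i f u u'|Y i j ij Yij].
  have E y : (fun j => Phi (upd Y i y j)) = upd (fun j => Phi (Y j)) i (Phi y).
    by apply/funext => j; rewrite /upd; case: eqP.
  rewrite !E linearD section_map_fscale kform_eval_tensorial pullbackD pullbackM.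
  by rewrite base_inv_pullbackK.
apply: smooth_eq => p; rewrite pullbackE.
by apply: (kform_alternating w ij); rewrite Yij.
Qed.

Lemma daggerK k (w : kform A k) : dagger_inv (dagger w) = w.
Proof. by apply: dagger_inj; rewrite dagger_invK. Qed.

Lemma dagger_pairing (xi : kform A 1) x :
  pairing (dagger xi) (Phi x) = pullback phi (pairing xi x).
Proof.
rewrite /pairing dagger_eval; congr (pullback _ (kform_eval _ _)).
by apply/funext => i; rewrite section_mapK.
Qed.

Lemma dagger_ev2 (w : kform A 2) x y :
  ev2 (dagger w) (Phi x) (Phi y) = pullback phi (ev2 w x y).
Proof.
rewrite /ev2 dagger_eval; congr (pullback _ (kform_eval _ _)).
by apply/funext => -[[|[|//]] ?]; rewrite section_mapK.
Qed.

Lemma dagger_kform0 f : dagger (kform0 A f) = kform0 A (pullback phi f).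
Proof. by apply: kform_ext => X; rewrite dagger_eval; exact: smooth_eq. Qed.

Lemma daggerD k (w z : kform A k) : dagger (w + z) = dagger w + dagger z.
Proof.
by apply: kform_ext => X; rewrite kform_evalD !dagger_eval kform_evalD pullbackD.
Qed.

Lemma dagger_kfscale k f (w : kform A k) :
  dagger (kfscale f w) = kfscale (pullback phi f) (dagger w).
Proof.
apply: kform_ext => X.
by rewrite kform_eval_kfscale !dagger_eval kform_eval_kfscale pullbackM.
Qed.

End DaggerTheory.

(** * Consequences of the graded algebra axioms in low degree *)

Section DGCA.
Context {R : realType} {n r : nat} {M : manifold R n} {A : inv_hom_bundle M r}.
Variable d : forall k, kform A k -> kform A k.+1.
Hypothesis d_dgca : @is_dgca R (fun k => kform A k) (kform0 A 1) (@kwedge R n r M A)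
                (@dagger R n r M A) (@dagger R n r M A) d.
Local Notation C := C^oo(M).
Local Notation phi := (base_map A).
Local Notation Phi := (section_map A).
Implicit Types (x y z : Gamma(A)) (f g : C).

(** In the instances below the two degrees are convertible, and equality proofs in [nat] are unique,
    so the casts disappear. *)
Lemma gcast_id (G : nat -> lmodType R) k (e : k = k) (a : G k) : gcast e a = a.
Proof. by rewrite /gcast (eq_irrelevance e erefl). Qed.

(* The unit law evaluates the sum over permutations. *)
Lemma kwedge0 k f (w : kform A k) : kwedge (kform0 A f) w = kfscale f w.
Proof.
apply: kform_eq => p v; rewrite kfscaleE -[in RHS](gmul1 (dgca_algebra d_dgca) w).
have E g : kwedge (kform0 A g) w p v = (0`! * k`!)%:R^-1 * \sum_(s : {perm 'I_(0 + k)})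
  (-1) ^+ s * (g p * w p (fun i => v (s (rshift 0 i)))) by [].
rewrite !E mulrCA; congr (_ * _); rewrite mulr_sumr; apply: eq_bigr => s _.
by rewrite smooth1 mul1r mulrCA.
Qed.

Lemma d_kfscale k f (w : kform A k) : d (kfscale f w) =
  kwedge (d (kform0 A f)) (dagger w) + kfscale (pullback phi f) (d w).
Proof.
have := dgca_leibniz d_dgca (kform0 A f) w.
by rewrite [gcast _ _]gcast_id expr0 scale1r dagger_kform0 !kwedge0.
Qed.

Lemma kwedgeC21 (w : kform A 2) (xi : kform A 1) : kwedge w xi = kwedge xi w.
Proof.
rewrite (gmulC (dgca_algebra d_dgca) w xi) [gcast _ _]gcast_id.
by rewrite -signr_odd /= scale1r.
Qed.

Lemma kwedgeC10 (xi : kform A 1) f : kwedge xi (kform0 A f) = kfscale f xi.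
Proof.
rewrite (gmulC (dgca_algebra d_dgca) xi (kform0 A f)) [gcast _ _]gcast_id.
by rewrite -signr_odd /= scale1r kwedge0.
Qed.

Lemma d_kform0M f g : d (kform0 A (f * g)) =
  kfscale (pullback phi g) (d (kform0 A f)) + kfscale (pullback phi f) (d (kform0 A g)).
Proof.
have -> : kform0 A (f * g) = kfscale f (kform0 A g) by exact: kform_eq.
rewrite d_kfscale dagger_kform0; congr (_ + _); exact: kwedgeC10.
Qed.

Lemma d_kwedge11 (xi zeta : kform A 1) : d (kwedge xi zeta) =
  kwedge (dagger zeta) (d xi) - kwedge (dagger xi) (d zeta).
Proof.
have := dgca_leibniz d_dgca xi zeta.
rewrite [gcast _ _]gcast_id expr1 scaleN1r => ->; congr (_ - _).
exact: kwedgeC21.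
Qed.

(** The action of the anchor on functions, expressed by [d] alone, before any bundle map is
    constructed. *)
Definition anchor_act x f : C := pairing (d (kform0 A f)) x.

Lemma kform0_linear (c : R) f g : kform0 A (c *: f + g) = c *: kform0 A f + kform0 A g.
Proof. exact: kform_eq. Qed.

Lemma anchor_act_fun_linear x : linear (anchor_act x).
Proof.
move=> c f g; rewrite /anchor_act kform0_linear (dgca_linear d_dgca).
by rewrite /pairing kform_evalD kform_evalZ.
Qed.

Lemma anchor_actD x f g : anchor_act x (f + g) = anchor_act x f + anchor_act x g.
Proof. by have := anchor_act_fun_linear x 1 f g; rewrite !scale1r. Qed.

Lemma anchor_actB x f g : anchor_act x (f - g) = anchor_act x f - anchor_act x g.
Proof.
by have := anchor_act_fun_linear x (-1) g f; rewrite !scaleN1r ![- _ + _]addrC.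
Qed.

Lemma anchor_actM x f g :
  anchor_act x (f * g) = pullback phi g * anchor_act x f + pullback phi f * anchor_act x g.
Proof. by rewrite /anchor_act d_kform0M; exact: smooth_eq. Qed.

Lemma anchor_act_map x f : anchor_act (Phi x) (pullback phi f) = pullback phi (anchor_act x f).
Proof. by rewrite /anchor_act -dagger_kform0 (dgca_d_sigma d_dgca) dagger_pairing. Qed.

End DGCA.

(** * Bracket identities *)

Section Decomposition.
Context {R : realType} {n r : nat} {M : manifold R n} {A : vbundle M r}.

Lemma kform2_ext (w z : kform A 2) : (forall x y, ev2 w x y = ev2 z x y) -> w = z.
Proof.
move=> wz; apply: kform_ext => X.
have -> : X = tnth [tuple X ord0; X (lift ord0 ord0)].
  by apply/funext => -[[|[|//]] ?]; congr X; apply: val_inj.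
exact: wz.
Qed.

Lemma ev2_suml (w : kform A 2) (I : Type) (s : seq I) (c : I -> C^oo(M)) u y :
  ev2 w (\sum_(b <- s) fscale (c b) (u b)) y = \sum_(b <- s) c b * ev2 w (u b) y.
Proof.
have E v : tnth [tuple v; y] = upd (tnth [tuple 0; y]) ord0 v by rewrite upd_pairl.
rewrite /ev2 E tensorial_sum; last exact: kform_eval_tensorial.
by apply: eq_bigr => b _; rewrite -E.
Qed.

Lemma ev2_sumr (w : kform A 2) (I : Type) (s : seq I) (c : I -> C^oo(M)) u x :
  ev2 w x (\sum_(b <- s) fscale (c b) (u b)) = \sum_(b <- s) c b * ev2 w x (u b).
Proof.
rewrite ev2_skew ev2_suml -sumrN; apply: eq_bigr => b _.
by rewrite ev2_skew mulrN opprK.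
Qed.

(* The factor [f ^+ 4 + f ^+ 4] counts each unordered pair of indices twice. *)
Lemma local_decomposition (w : kform A 2) p :
  exists (f : C^oo(M)) (u : 'I_r -> Gamma(A)) (e : 'I_r -> kform A 1),
  f p = 1 /\
  kfscale (f ^+ 4 + f ^+ 4) w =
    \sum_a \sum_b kfscale (ev2 w (u a) (u b)) (kwedge (e a) (e b)).
Proof.
have [j jp] := triv_cover A p.
have [f [u [e [/nbhs_singleton fp _ _ fue]]]] := local_frame jp.
exists f, u, e; split=> //; apply: kform2_ext => x y.
have fx (z : Gamma(A)) : fscale (f ^+ 2) z = \sum_b fscale (pairing (e b) z) (u b).
  apply: section_eq => q; rewrite section_sum fscaleE -[(f ^+ 2) q]/(f q ^+ 2).
  exact: fue.
(* Expanding both arguments costs a factor [f ^+ 2] each; antisymmetrizing [S] then produces the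
   wedges [kwedge (e a) (e b)]. *)
pose S x y := \sum_a \sum_b (pairing (e a) x * pairing (e b) y) * ev2 w (u a) (u b).
have SE x' y' : f ^+ 4 * ev2 w x' y' = S x' y'.
  transitivity (ev2 w (fscale (f ^+ 2) x') (fscale (f ^+ 2) y')).
    by rewrite ev2_fscalel ev2_fscaler; ring.
  rewrite !fx ev2_suml; apply: eq_bigr => a _; rewrite ev2_sumr mulr_sumr.
  by apply: eq_bigr => b _; rewrite mulrA.
have -> : ev2 (kfscale (f ^+ 4 + f ^+ 4) w) x y = S x y - S y x.
  rewrite -!SE (ev2_skew w y x) [LHS]kform_eval_kfscale -/(ev2 w x y); ring.
have evS (I : Type) (s : seq I) (F : I -> kform A 2) :
    ev2 (\sum_(i <- s) F i) x y = \sum_(i <- s) ev2 (F i) x y.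
  elim: s => [|i s IH]; first by rewrite !big_nil; exact: smooth_eq.
  by rewrite !big_cons -IH; exact: kform_evalD.
rewrite evS /S -sumrB; apply: eq_bigr => a _; rewrite evS -sumrB; apply: eq_bigr => b _.
by rewrite [RHS]kform_eval_kfscale -/(ev2 (kwedge (e a) (e b)) x y) wedge11; ring.
Qed.

End Decomposition.

Section ScalarLinear.
Context {R : realType} {n r : nat} {M : manifold R n} {A : vbundle M r}.
Implicit Types (x y z : Gamma(A)) (c : R).

Lemma smooth_scale c (f : C^oo(M)) : c *: (1 : C^oo(M)) * f = c *: f.
Proof. by apply: smooth_eq => p; rewrite smoothM !smoothZ smooth1 mulr1. Qed.

Lemma pairing_scale (xi : kform A 1) c x y :
  pairing xi (c *: x + y) = c *: pairing xi x + pairing xi y.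
Proof. by rewrite scale_fscale pairing_linear smooth_scale. Qed.

Lemma ev2_scaler (w : kform A 2) c x y z :
  ev2 w z (c *: x + y) = c *: ev2 w z x + ev2 w z y.
Proof. by rewrite scale_fscale ev2_linearr smooth_scale. Qed.

Lemma pairingD (xi : kform A 1) x y : pairing xi (x + y) = pairing xi x + pairing xi y.
Proof. by have := pairing_scale xi 1 x y; rewrite !scale1r. Qed.

Lemma pairing0 (xi : kform A 1) : pairing xi 0 = 0.
Proof.
have /eqP := pairingD xi 0 0.
by rewrite addr0 -subr_eq0 opprD addrA subrr add0r oppr_eq0 => /eqP.
Qed.

Lemma pairingN (xi : kform A 1) x : pairing xi (- x) = - pairing xi x.
Proof. by have := pairing_scale xi (-1) x 0; rewrite pairing0 !addr0 !scaleN1r. Qed.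

End ScalarLinear.

(** * Identities of the anchor and the bracket *)

Section Core.
Context {R : realType} {n r : nat} {M : manifold R n} {A : inv_hom_bundle M r}.
Variable d : forall k, kform A k -> kform A k.+1.
Hypothesis d_dgca : @is_dgca R (fun k => kform A k) (kform0 A 1) (@kwedge R n r M A)
                (@dagger R n r M A) (@dagger R n r M A) d.
Variable br : Gamma(A) -> Gamma(A) -> Gamma(A).
Local Notation C := C^oo(M).
Local Notation phi := (base_map A).
Local Notation Phi := (section_map A).
Local Notation act := (anchor_act d).
(** Testing against [dagger xi] keeps the inverse of [dagger] out of the computations. *)
Hypothesis brE : forall (xi : kform A 1) x y,
  pairing (dagger xi) (br x y) = - ev2 (d xi) (Phi x) (Phi y)
    + act (Phi x) (pairing xi y) - act (Phi y) (pairing xi x).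
Implicit Types (x y z : Gamma(A)) (f g : C) (xi : kform A 1).

Let act_add := anchor_actD d_dgca.
Let act_sub := anchor_actB d_dgca.
Let act_mul := anchor_actM d_dgca.

Lemma pairing_dagger_sep x y :
  (forall xi, pairing (dagger xi) x = pairing (dagger xi) y) -> x = y.
Proof. by move=> xy; apply: pairing_sep => xi; rewrite -(dagger_invK xi). Qed.

Lemma br_skew x y : br x y = - br y x.
Proof.
apply: pairing_dagger_sep => xi.
rewrite pairingN !brE (ev2_skew _ (Phi y)); ring.
Qed.

(** The anchor term arises from [act (Phi x)] differentiating [f] in the product of [f] and [xi(y)];
    the remaining factor, the pullback of [xi(y)], is [dagger xi] paired with [Phi y]. *)
Lemma br_leibniz x y f :
  br x (fscale f y) = fscale (pullback phi f) (br x y) + fscale (act (Phi x) f) (Phi y).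
Proof.
apply: pairing_dagger_sep => xi.
rewrite pairing_linear pairing_fscale !brE section_map_fscale ev2_fscaler.
rewrite !pairing_fscale act_mul dagger_pairing.
have -> : act (fscale (pullback phi f) (Phi y)) (pairing xi x) =
  pullback phi f * act (Phi y) (pairing xi x) by exact: pairing_fscale.
ring.
Qed.

Lemma br_linearr x : linear (br x).
Proof.
move=> c y z; apply: pairing_dagger_sep => xi.
rewrite pairing_scale !brE linearP ev2_scaler pairing_scale (anchor_act_fun_linear d_dgca).
rewrite [act (c *: _ + _) _]pairing_scale.
apply: smooth_eq => p; rewrite !(smoothD, smoothN, smoothZ); ring.
Qed.

Lemma br_linearl y : linear (br^~ y).
Proof.
move=> c x z /=; rewrite !(br_skew _ y) br_linearr.
by rewrite scalerN opprD.
Qed.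

Lemma br_map x y : Phi (br x y) = br (Phi x) (Phi y).
Proof.
apply: pairing_dagger_sep => xi; rewrite -(dagger_invK xi).
move: (dagger_inv xi) => {}xi.
(* Against [dagger (dagger xi)], every term is compatible with the pullback along [phi]. *)
rewrite dagger_pairing !brE (dgca_d_sigma d_dgca) dagger_ev2 !dagger_pairing.
by rewrite !(anchor_act_map d_dgca); exact: smooth_eq.
Qed.

(** The bracket formula for the 1-form [d (kform0 A f)], whose differential is zero. *)
Lemma act_br x y f : act (br x y) (pullback phi f) =
  act (Phi x) (act y f) - act (Phi y) (act x f).
Proof.
rewrite {1}/anchor_act -dagger_kform0 (dgca_d_sigma d_dgca) brE (dgca_dd d_dgca).
by rewrite (_ : ev2 0 _ _ = 0) ?oppr0 ?add0r//; exact: smooth_eq.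
Qed.

(** * The Cartan formula for 2-forms *)

Section Cartan.
Variables y1 y2 y3 : Gamma(A).

(** Left side minus right side of the Cartan formula for [d w]. *)
Let defect (w : kform A 2) : C :=
  ev3 (d w) (Phi y1) (Phi y2) (Phi y3)
  - (act (Phi y1) (ev2 w y2 y3) + act (Phi y2) (ev2 w y3 y1) + act (Phi y3) (ev2 w y1 y2))
  + (ev2 (dagger w) (br y1 y2) (Phi y3) + ev2 (dagger w) (br y2 y3) (Phi y1)
     + ev2 (dagger w) (br y3 y1) (Phi y2)).

Lemma defectD w w' : defect (w + w') = defect w + defect w'.
Proof.
have dD : d (w + w') = d w + d w'.
  by have := dgca_linear d_dgca 1 w w'; rewrite !scale1r.
by rewrite /defect dD daggerD /ev3 /ev2 !kform_evalD !act_add; ring.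
Qed.

(** The terms differentiating [f] cancel: those of [d] come from the wedge with [d (kform0 A f)],
    those of [act] from its Leibniz rule, and [dagger_ev2] identifies them. *)
Lemma defect_kfscale f w : defect (kfscale f w) = pullback phi f * defect w.
Proof.
rewrite /defect (d_kfscale d_dgca) dagger_kfscale.
have -> : ev3 (kwedge (d (kform0 A f)) (dagger w) + kfscale (pullback phi f) (d w))
    (Phi y1) (Phi y2) (Phi y3) =
  ev3 (kwedge (d (kform0 A f)) (dagger w)) (Phi y1) (Phi y2) (Phi y3) +
  pullback phi f * ev3 (d w) (Phi y1) (Phi y2) (Phi y3).
  by rewrite /ev3 kform_evalD kform_eval_kfscale.
have evE w' x y g : ev2 (kfscale g w') x y = g * ev2 w' x y by exact: kform_eval_kfscale.
rewrite wedge12 !evE !act_mul !dagger_ev2 /anchor_act; ring.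
Qed.

(** [brE] solved for [d] is the Cartan formula in degree one; substituted into the Leibniz rule for
    the wedge, it leaves a polynomial identity. *)
Lemma defect_kwedge xi zeta : defect (kwedge xi zeta) = 0.
Proof.
rewrite /defect (d_kwedge11 d_dgca) [@dagger _ _ _ _ _ 2 _](gendM (dgca_sigma d_dgca) xi zeta).
have -> : ev3 (kwedge (dagger zeta) (d xi) - kwedge (dagger xi) (d zeta))
    (Phi y1) (Phi y2) (Phi y3) =
  ev3 (kwedge (dagger zeta) (d xi)) (Phi y1) (Phi y2) (Phi y3)
  - ev3 (kwedge (dagger xi) (d zeta)) (Phi y1) (Phi y2) (Phi y3).
  by rewrite /ev3 kform_evalB.
have dE eta x y : ev2 (d eta) (Phi x) (Phi y) =
    act (Phi x) (pairing eta y) - act (Phi y) (pairing eta x) - pairing (dagger eta) (br x y).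
  by rewrite brE; ring.
by rewrite !wedge12 !wedge11 !dE !act_sub !act_mul !dagger_pairing; ring.
Qed.

Lemma cartan2 (w : kform A 2) : ev3 (d w) (Phi y1) (Phi y2) (Phi y3) =
  act (Phi y1) (ev2 w y2 y3) + act (Phi y2) (ev2 w y3 y1) + act (Phi y3) (ev2 w y1 y2)
  - (ev2 (dagger w) (br y1 y2) (Phi y3) + ev2 (dagger w) (br y2 y3) (Phi y1)
     + ev2 (dagger w) (br y3 y1) (Phi y2)).
Proof.
apply/eqP; rewrite -subr_eq0 opprB addrCA addrC -/(defect w) ; apply/eqP.
apply: smooth_eq => p.
have defectS (I : Type) (s : seq I) (F : I -> kform A 2) :
    (forall i, defect (F i) = 0) -> defect (\sum_(i <- s) F i) = 0.
  move=> F0; elim: s => [|i s IH].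
    rewrite big_nil; have /eqP := defectD 0 0.
    by rewrite addr0 -subr_eq0 opprD addrA subrr add0r oppr_eq0 => /eqP.
  by rewrite big_cons defectD F0 IH addr0.
(* The decomposition is taken at [phi p], because the defect multiplies by the pullback of the
   cut-off factor, which at [p] is its value at [phi p]. *)
have [f [u [e [fp fw]]]] := local_decomposition w (phi p).
have : defect (kfscale (f ^+ 4 + f ^+ 4) w) p = 0.
  rewrite fw defectS// => a; apply: defectS => b.
  by rewrite defect_kfscale defect_kwedge mulr0.
rewrite defect_kfscale smoothM pullbackE smoothD -[(f ^+ 4) _]/(f (phi p) ^+ 4).
(* The factor is [1 + 1] at that point, hence nonzero. *)
by rewrite fp expr1n => /eqP; rewrite mulf_eq0 => /orP[|/eqP//];
   rewrite -(natrD _ 1 1) pnatr_eq0.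
Qed.

End Cartan.

Lemma br_jacobi x y z :
  br (Phi x) (br y z) + br (Phi y) (br z x) + br (Phi z) (br x y) = 0.
Proof.
apply: pairing_dagger_sep => xi; rewrite -(dagger_invK xi).
move: (dagger_inv xi) => {}xi.
have dE eta u v : ev2 (d eta) (Phi u) (Phi v) =
    act (Phi u) (pairing eta v) - act (Phi v) (pairing eta u) - pairing (dagger eta) (br u v).
  by rewrite brE; ring.
(* As [dagger] commutes with [d] and the bracket of [Phi u] and [Phi v] is [Phi (br u v)], [dE]
   applies to [dagger xi]; then [act_br] expands the action of the bracket. *)
have dtE u v w : ev2 (dagger (d xi)) (br (Phi u) (Phi v)) (Phi (Phi w)) =
    act (Phi (Phi u)) (act (Phi v) (pairing xi w))
    - act (Phi (Phi v)) (act (Phi u) (pairing xi w))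
    - act (Phi (Phi w)) (pairing (dagger xi) (br u v))
    - pairing (dagger (dagger xi)) (br (br u v) (Phi w)).
  rewrite -(dgca_d_sigma d_dgca) -br_map dE br_map dagger_pairing act_br; ring.
(* With [w = d xi] the left side vanishes; all terms with [act] cancel, leaving only the double
   brackets. *)
have := cartan2 (Phi x) (Phi y) (Phi z) (d xi).
rewrite (dgca_dd d_dgca) (_ : ev3 0 _ _ _ = 0); last exact: smooth_eq.
rewrite !dE !act_sub !dtE => cartan.
(* Skew-symmetry moves the inner brackets to the left slot, as in [dtE]. *)
rewrite pairing0 !pairingD !(br_skew (Phi _)) !pairingN.
rewrite -oppr0 [in RHS]cartan; ring.
Qed.

End Core.

(** * Existence of the anchor and the bracket, uniqueness of the anchor *)

Section Construction.
Context {R : realType} {n r : nat} {M : manifold R n} {A : inv_hom_bundle M r}.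
Variable d : forall k, kform A k -> kform A k.+1.
Hypothesis d_dgca : @is_dgca R (fun k => kform A k) (kform0 A 1) (@kwedge R n r M A)
                (@dagger R n r M A) (@dagger R n r M A) d.
Local Notation C := C^oo(M).
Local Notation phi := (base_map A).
Local Notation Phi := (section_map A).
Implicit Types (x y : Gamma(A)) (f g : C).

(** The Leibniz rule for [d] on functions pulls the undifferentiated factors back along [phi], so
    the derivation sits at [phi p]; hence the anchor takes values in the pullback of the tangent
    bundle. *)
Lemma anchor_derivation p (v : A p) :
  (fun f : C => d (kform0 A f) p (fun=> v)) \in point_derivation (phi p).
Proof.
rewrite inE /=; split=> [c f g|f g].
  by rewrite kform0_linear (dgca_linear d_dgca).
by rewrite (d_kform0M d_dgca) kformD !kfscaleE !pullbackE; ring.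
Qed.

Lemma anchor_exists :
  exists a : anchor_map A, forall x f, section_act a x f = anchor_act d x f.
Proof.
pose b p (v : A p) : tangent (phi p) := Tangent (anchor_derivation v).
have bl p : linear (@b p).
  move=> c u v; apply: val_inj; apply/funext => f /=.
  have E (t : A p) : (fun=> t) = upd (fun=> 0) (ord0 : 'I_1) t.
    by apply/funext => i; rewrite /upd ord1.
  by rewrite (E (_ + _)) kform_multilinear -!E.
have bs x f : fun_smooth (fun p => b p (x p) f).
  exact: (smooth_val_smooth (anchor_act d x f)).
by exists (BundleMapToPullbackTangent bl bs) => x f; exact: smooth_eq.
Qed.

(** Every vector is the value of a global section, and tangent vectors are determined by their
    action on functions. *)
Lemma anchor_ext (a b : anchor_map A) :
  (forall x f, section_act a x f = section_act b x f) -> a = b.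
Proof.
case: a b => [a al a_s] [b bl bs] ab.
have E : a = b.
  apply/functional_extensionality_dep => p; apply/funext => v.
  have [x xp] := section_through v; apply: val_inj; apply/funext => f.
  by have := congr1 (fun g : C => g p) (ab x f); rewrite /= xp.
by case: _ / E in bl bs ab *; congr BundleMapToPullbackTangent; exact: Prop_irrelevance.
Qed.

(** The right-hand side [L x y] is additive in [xi] and linear over functions up to pullback along
    [phi]. Composing with [dagger_inv] removes the pullback, so [section_of_functional] yields the
    section. *)
Lemma bracket_exists : exists br : Gamma(A) -> Gamma(A) -> Gamma(A),
  forall (xi : kform A 1) x y, pairing (dagger xi) (br x y) =
    - ev2 (d xi) (Phi x) (Phi y)
    + anchor_act d (Phi x) (pairing xi y) - anchor_act d (Phi y) (pairing xi x).
Proof.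
pose L x y (xi : kform A 1) : C := - ev2 (d xi) (Phi x) (Phi y)
  + anchor_act d (Phi x) (pairing xi y) - anchor_act d (Phi y) (pairing xi x).
have LD x y xi zeta : L x y (xi + zeta) = L x y xi + L x y zeta.
  have dD : d (xi + zeta) = d xi + d zeta.
    by have := dgca_linear d_dgca 1 xi zeta; rewrite !scale1r.
  by rewrite /L dD /ev2 /pairing !kform_evalD !(anchor_actD d_dgca); ring.
(* The derivatives of [f] produced by [act] cancel against the wedge with [d (kform0 A f)]. *)
have LZ x y f xi : L x y (kfscale f xi) = pullback phi f * L x y xi.
  have pE z : pairing (kfscale f xi) z = f * pairing xi z by exact: kform_eval_kfscale.
  have dE : ev2 (d (kfscale f xi)) (Phi x) (Phi y) =
      ev2 (kwedge (d (kform0 A f)) (dagger xi)) (Phi x) (Phi y)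
      + pullback phi f * ev2 (d xi) (Phi x) (Phi y).
    by rewrite (d_kfscale d_dgca) /ev2 kform_evalD kform_eval_kfscale.
  rewrite /L dE wedge11 !pE !(anchor_actM d_dgca) !dagger_pairing /anchor_act; ring.
have ex x y : exists z : Gamma(A), forall xi, pairing (dagger xi) z = L x y xi.
  have [|f xi|z zE] := @section_of_functional _ _ _ _ A (L x y \o @dagger_inv _ _ _ _ A 1).
  - move=> xi zeta /=; rewrite -LD; congr L.
    by apply: dagger_inj; rewrite daggerD !dagger_invK.
  - rewrite /= -[in RHS](base_map_pullbackK A f) -LZ; congr L.
    by apply: dagger_inj; rewrite dagger_kfscale !dagger_invK base_map_pullbackK.
  - by exists z => xi; rewrite zE /= daggerK.
have /choice[br brE] (xy : Gamma(A) * Gamma(A)) := ex xy.1 xy.2.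
by exists (fun x y => br (x, y)) => xi x y; rewrite brE.
Qed.

End Construction.

(** * Well-definedness of anchor and bracket, and the Hom-Lie algebroid axioms *)

Theorem theorem3p8 (R : realType) (n r : nat) (M : manifold R n)
    (A : inv_hom_bundle M r) (d : forall k, kform A k -> kform A k.+1)
    (d_dgca : @is_dgca R (fun k => kform A k) (kform0 A 1) (@kwedge R n r M A)
                (@dagger R n r M A) (@dagger R n r M A) d) :
  let phiA := section_map A in
  let anchor_def (a : anchor_map A) : Prop :=
    forall (x : Gamma(A)) (f : C^oo(M)),
      section_act a x f = pairing (d 0%N (kform0 A f)) x in
  let bracket_def (a : anchor_map A) (br : Gamma(A) -> Gamma(A) -> Gamma(A)) : Prop :=
    forall (xi : kform A 1) (x1 x2 : Gamma(A)),
      pairing xi (br x1 x2) =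
        - kform_eval (d 1%N (dagger_inv xi)) (tnth [tuple phiA x1; phiA x2])
        + section_act a (phiA x1) (pairing (dagger_inv xi) x2)
        - section_act a (phiA x2) (pairing (dagger_inv xi) x1) in
  (exists! ab : anchor_map A * (Gamma(A) -> Gamma(A) -> Gamma(A)),
      anchor_def ab.1 /\ bracket_def ab.1 ab.2) /\
  (forall (a : anchor_map A) (br : Gamma(A) -> Gamma(A) -> Gamma(A)),
      anchor_def a -> bracket_def a br -> is_hom_lie_algebroid br a).
Proof.
move=> phiA anchor_def bracket_def; split.
  have [a aE] := anchor_exists d_dgca; have [br brE] := bracket_exists d_dgca.
  exists (a, br); split=> [|[a' br'] /= [a'E br'E]].
    by split=> // xi x y; rewrite -[in LHS](dagger_invK xi) /= brE !aE.
  have aa' : a = a' by apply: anchor_ext => x f; rewrite aE a'E.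
  congr (_, _) => //; apply/funext => x; apply/funext => y; apply: pairing_sep => xi.
  by rewrite br'E -[in LHS](dagger_invK xi) brE -aa' !aE.
move=> a br aE br_def.
have actE x f : section_act a x f = anchor_act d x f by exact: aE.
(* Substituting [dagger xi] for the test form brings the definition of the bracket to the form used
   in the identities. *)
have brE (xi : kform A 1) x y : pairing (dagger xi) (br x y) =
    - ev2 (d 1%N xi) (phiA x) (phiA y)
    + anchor_act d (phiA x) (pairing xi y) - anchor_act d (phiA y) (pairing xi x).
  by rewrite br_def daggerK !actE.
split.
- split.
  + exact: (br_linearl d_dgca brE).
  + exact: (br_linearr d_dgca brE).
  + exact: (br_skew brE).
  + exact: linearP.
  + exact: (br_map d_dgca brE).
  + exact: (br_jacobi d_dgca brE).
- by move=> x y f; rewrite (br_leibniz d_dgca brE) actE.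
- split.
  + by move=> c f g; exact: smooth_eq.
  + by move=> x c f g; rewrite !actE; exact: anchor_act_fun_linear.
  + by move=> f c x y; rewrite !actE; exact: pairing_scale.
  + by move=> x f; rewrite !actE; exact: anchor_act_map.
  + by move=> x y f; rewrite !actE; exact: (act_br d_dgca brE).
Qed.
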